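(* Let $K_1,\dots,K_n\in\mathcal F_0$ and $\alpha\in\{1,2,3\}$. (i) If $-n<t<0<r<s$ or $-n<s<0<r<t$, then $$G_r^{(\alpha)}(K_1,\dots,K_n)\le[G_s^{(\alpha)}(K_1,\dots,K_n)]^{\frac{(t-r)(n+s)}{(t-s)(n+r)}}\,[G_t^{(\alpha)}(K_1,\dots,K_n)]^{\frac{(r-s)(n+t)}{(t-s)(n+r)}}.$$ (ii) If $-n<t<r<s<0$ or $-n<s<r<t<0$, then $$G_r^{(\alpha)}(K_1,\dots,K_n)\le[G_s^{(\alpha)}(K_1,\dots,K_n)]^{\frac{(t-r)(n+s)}{(t-s)(n+r)}}\,[G_t^{(\alpha)}(K_1,\dots,K_n)]^{\frac{(r-s)(n+t)}{(t-s)(n+r)}}.$$ (iii) If $t<r<-n<s<0$ or $s<r<-n<t<0$, then $$G_r^{(\alpha)}(K_1,\dots,K_n)\ge[G_s^{(\alpha)}(K_1,\dots,K_n)]^{\frac{(t-r)(n+s)}{(t-s)(n+r)}}\,[G_t^{(\alpha)}(K_1,\dots,K_n)]^{\frac{(r-s)(n+t)}{(t-s)(n+r)}}.$$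
   Context: Notation in $\mathbb R^n$: $S^{n-1}$ is the unit sphere with spherical measure $\sigma$ and $|\cdot|$ is volume. $\mathcal K_0$ is the set of convex bodies (compact convex sets) containing the origin in their interior. For $K\in\mathcal K_0$: $h_K(u)=\max_{x\in K}\langle x,u\rangle$ and $K^\circ=\{x:\langle x,y\rangle\le1\ \forall y\in K\}$, with radial function $\rho_{K^\circ}=1/h_K$ on $S^{n-1}$. $\mathcal F_0$ is the set of $K\in\mathcal K_0$ whose surface area measure $S(K,\cdot)$ on $S^{n-1}$ is absolutely continuous with respect to $\sigma$, with density $f_K$ (curvature function); $f_p(K,u)=h_K(u)^{1-p}f_K(u)$ for $p\in\mathbb R$. For $\mathbf K=(K_1,\dots,K_n)\in\mathcal F_0^n$ and $\mathbf L=(L_1,\dots,L_n)\in\mathcal K_0^n$, $$V_p(\mathbf K;\mathbf L)=\frac1n\int_{S^{n-1}}\prod_{i=1}^n\big[h_{L_i}(u)^pf_p(K_i,u)\big]^{\frac1n}d\sigma(u),\qquad \widetilde V(\mathbf L^\circ)=\frac1n\int_{S^{n-1}}\prod_{i=1}^n\rho_{L_i^\circ}(u)\,d\sigma(u).$$ Mixed $L_p$ geominimal surface areas, for $p>0$: $$G_p^{(1)}(K_1,\dots,K_n)=\inf_{L\in\mathcal K_0}\Big\{nV_p(\mathbf K;L,\dots,L)^{\frac n{n+p}}|L^\circ|^{\frac p{n+p}}\Big\},$$ $$G_p^{(2)}(K_1,\dots,K_n)=\inf_{\mathbf L\in\mathcal K_0^n}\Big\{nV_p(\mathbf K;\mathbf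 L)^{\frac n{n+p}}\prod_{i=1}^n|L_i^\circ|^{\frac p{(n+p)n}}\Big\},$$ $$G_p^{(3)}(K_1,\dots,K_n)=\inf_{\mathbf L\in\mathcal K_0^n}\Big\{nV_p(\mathbf K;\mathbf L)^{\frac n{n+p}}\widetilde V(\mathbf L^\circ)^{\frac p{n+p}}\Big\}.$$ For $p<0$, $p\ne-n$, the same formulas with each $\inf$ replaced by $\sup$. Infima, suprema and the inequalities are understood in $[0,+\infty]$, with $0^a=+\infty$ and $(+\infty)^a=0$ for $a<0$, and $0\cdot(+\infty)=0$. *)

(* Defs.v *)
From HB Require Import structures.
From mathcomp Require Import all_boot all_order all_algebra.
From mathcomp Require Import all_classical all_reals all_analysis.

Set Implicit Arguments.
Unset Strict Implicit.
Unset Printing Implicit Defensive.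

Import Order.TTheory GRing.Theory Num.Def Num.Theory.
Import numFieldNormedType.Exports.

Local Open Scope classical_set_scope.
Local Open Scope ring_scope.

(* 'rV[R]_n carries the product sigma-algebra of the Borel sigma-algebra of R,
   i.e. the Borel sigma-algebra of R^n, as n.-tuple R does in the library. *)
Section measurable_row.
Context {d} {T : sigmaRingType d}.
Variable n : nat.

Let coordinates (i : 'I_n) (x : 'rV[T]_n) : T := x ord0 i.

Let row_set0 : g_sigma_preimage coordinates set0.
Proof. exact: sigma_algebra0. Qed.

Let row_setC A : g_sigma_preimage coordinates A ->
  g_sigma_preimage coordinates (~` A).
Proof. exact: sigma_algebraC. Qed.

Let row_bigcup (F : (set 'rV[T]_n)^nat) :
  (forall i, g_sigma_preimage coordinates (F i)) ->
  g_sigma_preimage coordinates (\bigcup_i (F i)).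
Proof. exact: sigma_algebra_bigcup. Qed.

HB.instance Definition _ := @isMeasurable.Build (measure_tuple_display d)
  'rV[T]_n (g_sigma_preimage coordinates) row_set0 row_setC row_bigcup.

End measurable_row.

Section measures.
Context {R : realType}.

Definition dotv n (x y : 'rV[R]_n) : R := \sum_(i < n) x ord0 i * y ord0 i.

(* The library norm `|x| on matrices is the sup norm, not this one. *)
Definition enorm n (x : 'rV[R]_n) : R := Num.sqrt (dotv x x).

Definition sphere n : set 'rV[R]_n := [set u | enorm u = 1].

(* n-dimensional Lebesgue measure, as the product measure on
   R^(n+1) = R x R^n. *)
Fixpoint volume n : set 'rV[R]_n -> \bar R :=
  match n with
  | 0 => dirac (0 : 'rV[R]_0)
  | m.+1 => pushforward (lebesgue_measure \x @volume m)%E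
              (fun p : R * 'rV[R]_m => row_mx p.1%:M p.2 : 'rV[R]_(1 + m))
  end.

(* n times the volume of the cone { r u : 0 < r <= 1, u in A }, which is the
   measure entering integration in polar coordinates. *)
Definition spherical_measure n (A : set 'rV[R]_n) : \bar R :=
  (n%:R%:E * volume [set x : 'rV[R]_n |
                      (0 < enorm x <= 1)%R /\ A ((enorm x)^-1 *: x)%R])%E.

Definition ediam n (A : set 'rV[R]_n) : \bar R :=
  ereal_sup [set (enorm (p.1 - p.2))%:E | p in A `*` A].

(* m-dimensional Hausdorff measure, normalised by the volume of the unit ball
   of R^m so as to agree with volume on R^m.  The empty set contributes 0 also
   for m = 0, where 0 ^+ 0 = 1. *)
Definition hausdorff_weight n (m : nat) (U : set 'rV[R]_n) : \bar R :=
  if U == set0 then 0%E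
  else (volume [set x : 'rV[R]_m | (enorm x <= 1)%R]
        * ((fine (ediam U) / 2) ^+ m)%:E)%E.

Definition hausdorff_content n (m : nat) (delta : R) (A : set 'rV[R]_n) :
    \bar R :=
  ereal_inf [set (\sum_(0 <= k <oo) hausdorff_weight m (U k))%E
            | U in [set U : (set 'rV[R]_n)^nat | A `<=` \bigcup_k U k /\
                      forall k, (ediam (U k) <= delta%:E)%E]].

Definition hausdorff_measure n (m : nat) (A : set 'rV[R]_n) : \bar R :=
  ereal_sup [set hausdorff_content m delta A
            | delta in [set delta : R | 0 < delta]].

End measures.

Section bodies.
Context {R : realType} {n : nat}.
Implicit Types K L : set 'rV[R]_n.

Definition K0 : set (set 'rV[R]_n) :=
  [set K : set 'rV[R]_n | [/\ compact K, convex_set K & K° 0]].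

Definition support_function K (u : 'rV[R]_n) : R :=
  sup [set dotv x u | x in K].

Definition polar K : set 'rV[R]_n :=
  [set x | forall y, K y -> dotv x y <= 1].

Definition radial_function K (u : 'rV[R]_n) : R :=
  sup [set c : R | 0 <= c /\ K (c *: u)].

(* S(K, A): area of the boundary points with an outer unit normal in A. *)
Definition surface_area_measure K (A : set 'rV[R]_n) : \bar R :=
  hausdorff_measure n.-1
    [set x | (closure K `\` K°) x /\
       exists u, [/\ sphere u, A u & dotv x u = support_function K u]].

Definition is_curvature_function K (f : 'rV[R]_n -> R) : Prop :=
  [/\ (@spherical_measure R n).-integrable (@sphere R n) (EFin \o f),
      forall u, sphere u -> 0 <= f u &
      forall A, measurable A -> A `<=` @sphere R n ->
        surface_area_measure K A = (\int[@spherical_measure R n]_(u in A) (f u)%:E)%E].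

Definition F0 : set (set 'rV[R]_n) :=
  [set K : set 'rV[R]_n | [/\ K0 K, surface_area_measure K `<< @spherical_measure R n &
               exists f, is_curvature_function K f]].

(* Meaningful for K in F0; unique up to spherical_measure-null sets. *)
Definition curvature_function K : 'rV[R]_n -> R :=
  xget (fun=> 0) [set f | is_curvature_function K f].

Definition Lp_curvature_function (p : R) K (u : 'rV[R]_n) : R :=
  support_function K u `^ (1 - p) * curvature_function K u.

End bodies.

Section geominimal.
Context {R : realType} {n : nat}.
Implicit Types K L : 'I_n -> set 'rV[R]_n.
Local Open Scope ereal_scope.

(* x ^ a on [0, +oo] with 0 ^ a = +oo and (+oo) ^ a = 0 for a < 0; the library
   poweR gives 0 and +oo instead.  (inve 0 = +oo, inve +oo = 0.) *)
Definition epower (x : \bar R) (a : R) : \bar R :=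
  if (0 <= a)%R then poweR x a else (poweR x (- a))^-1.

Definition Vp (p : R) K L : \bar R :=
  (n%:R^-1)%:E * \int[@spherical_measure R n]_(u in @sphere R n)
    (\prod_(i < n) (support_function (L i) u `^ p
                    * Lp_curvature_function p (K i) u) `^ n%:R^-1)%R%:E.

(* To be applied to the polar bodies of L. *)
Definition dual_mixed_volume L : \bar R :=
  (n%:R^-1)%:E * \int[@spherical_measure R n]_(u in @sphere R n)
    (\prod_(i < n) radial_function (L i) u)%R%:E.

(* inf for p > 0, sup for p < 0; the values p = 0 and p = -n are excluded. *)
Definition optimum (p : R) (E : set (\bar R)) : \bar R :=
  if (0 < p)%R then ereal_inf E else ereal_sup E.

Definition geominimal1 (p : R) K : \bar R :=
  optimum p
    [set n%:R%:E * epower (Vp p K (fun=> L)) (n%:R / (n%:R + p))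
         * epower (volume (polar L)) (p / (n%:R + p))
    | L in K0].

Definition geominimal2 (p : R) K : \bar R :=
  optimum p
    [set n%:R%:E * epower (Vp p K L) (n%:R / (n%:R + p))
         * \prod_(i < n)
             epower (volume (polar (L i))) (p / ((n%:R + p) * n%:R))
    | L in [set L : 'I_n -> set 'rV[R]_n | forall i, K0 (L i)]].

Definition geominimal3 (p : R) K : \bar R :=
  optimum p
    [set n%:R%:E * epower (Vp p K L) (n%:R / (n%:R + p))
         * epower (dual_mixed_volume (fun i => polar (L i))) (p / (n%:R + p))
    | L in [set L : 'I_n -> set 'rV[R]_n | forall i, K0 (L i)]].

End geominimal.

(* alpha = 0, 1, 2 stand for the upper indices (1), (2), (3). *)
Definition geominimal (R : realType) (n : nat) (alpha : 'I_3) (p : R)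
    (K : 'I_n -> set 'rV[R]_n) : \bar R :=
  match val alpha with
  | 0 => geominimal1 p K
  | 1 => geominimal2 p K
  | _ => geominimal3 p K
  end.

(* Main.v *)
Require Import Defs.
From HB Require Import structures.
From mathcomp Require Import all_boot all_order all_algebra.
From mathcomp Require Import all_classical all_reals all_analysis.
From mathcomp Require Import measurable_realfun ring lra.

(* For a family L put phi = prod_i (h_{K_i} f_{K_i})^(1/n) and
   q = prod_i h_{L_i} / h_{K_i}, so that V_p(K; L) = (1/n) int phi q^(p/n).
   Hoelder's inequality makes p |-> V_p(K; L) log-convex, so for each fixed L
   the functional under the infimum or supremum satisfies the claimed
   inequality, reversed when n + r < 0, and one optimises over L.  In (i) the
   right-hand side could a priori be 0 * oo; this is excluded by a positive
   lower bound for G_s, s > 0: phi is bounded below on a set of positive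
   measure, and each h_{L_i} is bounded below on most of it, since a cone over
   the part of the sphere where h_{L_i} is small is contained in the polar body
   of L_i.  If phi = 0 almost everywhere, then G_r is 0 for r > -n and +oo for
   r < -n. *)

Set Implicit Arguments.
Unset Strict Implicit.
Unset Printing Implicit Defensive.

Import Order.TTheory GRing.Theory Num.Def Num.Theory.
Import numFieldNormedType.Exports.

Local Open Scope classical_set_scope.
Local Open Scope ring_scope.

(** * Lebesgue measure on row vectors *)

(** The exponents of the claim come from the weights l = (t - r)/(t - s) and m = (r - s)/(t - s),
    for which r = l s + m t. Raising V_r <= V_s^l V_t^m to the power n/(n + r) produces them, and
    the powers of n and of the polar factor then agree exactly, so at fixed L the only loss is in
    Hoelder's inequality. How one optimises depends on signs. For t < 0 < r < s both exponents are
    positive, but the s-term is an infimum and the t-term a supremum: the latter is bounded by its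
    supremum at each L, and the infimum is taken last. For t < r < -n < s < 0 the exponent of the
    s-term is negative, so bounding that term by its supremum lowers the right-hand side, and the
    supremum of the t-term is taken last. The lower bound for G_s must be uniform in L. The
    threshold below which the product of the h_{L_i} counts as small is therefore adapted to the
    polar factor of L, so that the exceptional set covers at most half of the set where phi is
    bounded below. For the third kind of area Chebyshev's inequality for the dual mixed volume
    replaces the cone argument. *)

Section row_measurability.
Context {R : realType}.

Lemma measurable_coord n (i : 'I_n) :
  measurable_fun [set: 'rV[R]_n] (fun x : 'rV[R]_n => x ord0 i : R).
Proof.
move=> _ Y mY; rewrite setTI; apply: sub_sigma_algebra => /=.
rewrite -bigcup_seq/=; exists i => /=; first by rewrite mem_index_enum.
by exists Y => //; rewrite setTI.
Qed.

Lemma measurable_fun_coordP d (T : measurableType d) n (f : T -> 'rV[R]_n) :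
  (forall i, measurable_fun [set: T] (fun t => f t ord0 i : R)) ->
  measurable_fun [set: T] f.
Proof.
move=> mf _ A mA; rewrite setTI.
pose C := [set B : set 'rV[R]_n | measurable (f @^-1` B)].
suff : measurable `<=` C by apply.
apply: smallest_sub.
  split.
  - by rewrite /C/= preimage_set0.
  - by move=> B CB; rewrite /C/= setTD preimage_setC; exact: measurableC.
  - by move=> F CF; rewrite /C/= preimage_bigcup; exact: bigcupT_measurable.
case: n => [|n] in f mf A mA C *; first by rewrite big_ord0.
rewrite -bigcup_mkord_ord; apply: bigcup_sub => i Ii.
move=> A' [B mB <-]; rewrite /C/= setTI -[X in measurable X]setTI.
exact: (mf (inord i)).
Qed.

Lemma measurable_row_cons n :
  measurable_fun [set: R * 'rV[R]_n]
   (fun p : R * 'rV[R]_n => row_mx p.1%:M p.2 : 'rV[R]_(1 + n)).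
Proof.
apply: measurable_fun_coordP => i.
rewrite /row_mx; under eq_fun do rewrite mxE.
case: (splitP i) => j _.
  under eq_fun do rewrite mxE.
  by rewrite !ord1 eqxx /=; under eq_fun do rewrite mulr1n; exact: measurable_fst.
apply: (@measurableT_comp _ _ _ _ _ _ (fun x : 'rV[R]_n => x ord0 j : R)).
  exact: measurable_coord.
exact: measurable_snd.
Qed.

Definition box n (a b : R) : set 'rV[R]_n :=
  [set x | forall i, a < x ord0 i <= b].

Lemma measurable_box n a b : measurable (@box n a b).
Proof.
rewrite (_ : box a b = \big[setI/setT]_(i < n)
    ((fun x : 'rV[R]_n => x ord0 i : R) @^-1` `]a, b]%classic)).
  apply: bigsetI_measurable => i _; rewrite -[X in measurable X]setTI.
  exact: measurable_coord.
apply/seteqP; split => [x bx|x].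
  by rewrite -bigcap_seq => i _ /=; rewrite in_itv; exact: bx.
by rewrite -bigcap_seq => bx i; have /= := bx i (mem_index_enum i); rewrite in_itv.
Qed.

Lemma row_cons_preimage_box n a b :
  (fun p : R * 'rV[R]_n => row_mx p.1%:M p.2 : 'rV[R]_(1 + n)) @^-1` box a b
  = `]a, b]%classic `*` box a b.
Proof.
apply/seteqP; split => -[y x] /=.
  move=> h; split => [|i] /=.
    by have := h (lshift n ord0); rewrite row_mxEl mxE eqxx mulr1n in_itv.
  by have := h (rshift 1 i); rewrite row_mxEr.
move=> [/=]; rewrite in_itv /= => hy hx i; rewrite /row_mx mxE.
by case: splitP => j _ ; [rewrite mxE !ord1 eqxx mulr1n|].
Qed.

Lemma bigcup_box n : \bigcup_k @box n (- k.+1%:R) k.+1%:R = setT.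
Proof.
rewrite -subTset => x _.
exists (Num.truncn (\sum_i `|x ord0 i|)) => // i.
have : `|x ord0 i| < (Num.truncn (\sum_i `|x ord0 i|)).+1%:R.
  apply: le_lt_trans (truncnS_gt _).
  by rewrite (bigD1 i)//= lerDl sumr_ge0.
by rewrite ltr_norml => /andP[-> /ltW].
Qed.

Lemma lebesgue_measure_oc (a b : R) : a <= b ->
  @lebesgue_measure R `]a, b]%classic = (b - a)%:E.
Proof.
move=> ab; rewrite lebesgue_measure_itv/= lte_fin.
by case: ltgtP ab => // -> _; rewrite subrr.
Qed.

(** Existential form of the bundled structure, usable inside an induction where the next product
    measure asks for a sigma-finite second factor. *)
Lemma sigma_finite_measure_ex d (T : measurableType d)
    (m : {measure set T -> \bar R}) : sigma_finite setT m ->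
  exists mu : {sigma_finite_measure set T -> \bar R}, m = mu :> (set T -> \bar R).
Proof.
move=> sm; pose H1 := isSFinite.Build _ _ _ _ (sfinite_measure_sigma_finite sm).
pose H2 := isSigmaFinite.Build _ _ _ _ sm.
by exists (HB.pack_for {sigma_finite_measure set T -> \bar R} (Measure.sort m) H1 H2).
Qed.

(** The recursion defining [volume] only yields a set function. The induction carries
    sigma-finiteness because the product with the next line needs it, and the value on boxes because
    exhausting the space by boxes is what gives sigma-finiteness. *)
Lemma volume_measure_ex n : exists2 mu : {sigma_finite_measure set 'rV[R]_n -> \bar R},
  @volume R n = mu & forall a b, a <= b -> mu (box a b) = ((b - a) ^+ n)%:E.
Proof.
elim: n => [|n [mu Emu boxE]].
  exists (dirac (0 : 'rV[R]_0)) => // a b _.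
  by rewrite /= diracE expr0 mem_set// => -[].
have mf : measurable_fun [set: measurableTypeR R * 'rV[R]_n]
    (fun p : measurableTypeR R * 'rV[R]_n => row_mx p.1%:M p.2 : 'rV[R]_(1 + n)).
  exact: measurable_row_cons.
rewrite /= Emu; set f := (fun p : _ => _) in mf *.
pose m : {measure set 'rV[R]_n.+1 -> \bar R} :=
  measure_function_pushforward__canonical__measure_function_Measure
    (lebesgue_measure \x mu)%E mf.
have mE a b : a <= b -> m (box a b) = ((b - a) ^+ n.+1)%:E.
  move=> ab; rewrite /m /= /pushforward [f @^-1` _]row_cons_preimage_box.
  rewrite [LHS]product_measure1E//; last exact: measurable_box.
  by rewrite [X in (X * _)%E]lebesgue_measure_oc// [X in (_ * X)%E]boxE// exprS EFinM.
have sm : sigma_finite setT m.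
  exists (fun k => box (- k.+1%:R) k.+1%:R); first by rewrite bigcup_box.
  move=> k; split; first exact: measurable_box.
  by rewrite mE ?ltry// -subr_ge0 opprK addr_ge0.
by have [M mM] := sigma_finite_measure_ex sm; exists M; rewrite -?mM.
Qed.

Lemma volume_box n a b : a <= b -> volume (@box n a b) = ((b - a) ^+ n)%:E.
Proof. by have [mu -> +] := volume_measure_ex n; apply. Qed.

Let volume0 n : @volume R n set0 = 0%E.
Proof. by have [mu -> _] := volume_measure_ex n. Qed.

Let volume_ge0 n (A : set 'rV[R]_n) : (0 <= volume A)%E.
Proof. by have [mu -> _] := volume_measure_ex n. Qed.

Let volume_sigma_additive n : semi_sigma_additive (@volume R n).
Proof.
by have [mu -> _] := volume_measure_ex n; exact: measure_semi_sigma_additive.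
Qed.

HB.instance Definition _ n := isMeasure.Build _ _ _ (@volume R n)
  (@volume0 n) (@volume_ge0 n) (@volume_sigma_additive n).

Let volume_sigma_finite n : sigma_finite setT (@volume R n).
Proof. by have [mu -> _] := volume_measure_ex n; exact: sigma_finiteT. Qed.

HB.instance Definition _ n := Measure_isSigmaFinite.Build _ _ _ (@volume R n)
  (@volume_sigma_finite n).

Lemma volumeSE n (A : set 'rV[R]_n.+1) : volume A =
  (\int[@lebesgue_measure R]_y volume [set x : 'rV[R]_n | A (row_mx y%:M x)])%E.
Proof.
rewrite /= /pushforward /product_measure1; apply: eq_integral => y _ /=.
f_equal.
by apply/seteqP; split => x /=; rewrite /xsection /= inE.
Qed.

End row_measurability.

(** * Homogeneity of volume under dilations *)

Section scaling.
Context {R : realType}.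

(** The image of Lebesgue measure under multiplication by c, rescaled by c, gives ]a, b] the mass b
    - a, hence is Lebesgue measure by uniqueness. *)
Lemma ge0_integral_lebesgue_scale (c : R) (f : measurableTypeR R -> \bar R) : 0 < c ->
  measurable_fun [set: measurableTypeR R] f -> (forall y, (0 <= f y)%E) ->
  (\int[@lebesgue_measure R]_y f (c * y)%R =
   (c^-1)%:E * \int[@lebesgue_measure R]_y f y)%E.
Proof.
move=> c0 mf f0.
have mc : measurable_fun [set: measurableTypeR R]
   (fun y => c * y : measurableTypeR R).
  exact: mulrl_measurable.
pose m1 : {measure set (measurableTypeR R) -> \bar R} :=
  measure_function_pushforward__canonical__measure_function_Measure
    (@lebesgue_measure R) mc.
pose m2 : {measure set (measurableTypeR R) -> \bar R} :=
  mscale (NngNum (ltW c0)) m1.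
have lm A : measurable A -> @lebesgue_measure R A = m2 A.
  apply: lebesgue_measure_unique => _ [[a b] /= _ <-].
  rewrite /m2 /mscale /= /pushforward.
  have -> : (fun y => c * y) @^-1` `]a, b]%classic = `]c^-1 * a, c^-1 * b]%classic.
    apply/seteqP; split => y /=; rewrite !in_itv /=;
    by rewrite ltr_pdivrMl// ler_pdivlMl.
  have [ab|ba] := leP a b.
    rewrite !lebesgue_measure_oc//; last by rewrite ler_pM2l// invr_gt0.
    by rewrite -EFinM -mulrBr mulrA divff ?gt_eqF// mul1r.
  rewrite set_itv_ge; last by rewrite bnd_simp -leNgt ltW.
  rewrite set_itv_ge ?measure0 ?mule0//.
  by rewrite bnd_simp -leNgt ler_wpM2l ?invr_ge0// ltW.
transitivity (\int[m1]_y f y)%E.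
  by rewrite ge0_integral_pushforward.
rewrite [in RHS](@eq_measure_integral _ _ _ _ m2); last by move=> A mA _; exact: lm.
rewrite ge0_integral_mscale//=.
by rewrite muleA -EFinM mulVf ?gt_eqF// mul1e.
Qed.

Lemma measurable_scale n (c : R) :
  measurable_fun [set: 'rV[R]_n] (fun x : 'rV[R]_n => c *: x).
Proof.
apply: measurable_fun_coordP => i; under eq_fun do rewrite mxE.
by apply: measurable_funM => //; exact: measurable_coord.
Qed.

(** Induction by slicing: the slice at y of the preimage is the preimage of the slice of A at c y,
    and the substitution in y supplies the last factor c^-1. *)
Lemma volume_scale n (c : R) (A : set 'rV[R]_n) : 0 < c -> measurable A ->
  volume ((fun x => c *: x) @^-1` A) = ((c^-1 ^+ n)%:E * volume A)%E.
Proof.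
move=> c0; elim: n A => [|n IH] A mA.
  rewrite expr0 mul1e; congr (volume _); apply/seteqP.
  by split=> x; rewrite /preimage /= !thinmx0.
have mrow : measurable_fun [set: measurableTypeR R * 'rV[R]_n]
    (fun p : measurableTypeR R * 'rV[R]_n => row_mx p.1%:M p.2 : 'rV[R]_(1 + n)).
  exact: measurable_row_cons.
have mpA : measurable [set p : measurableTypeR R * 'rV[R]_n | A (row_mx p.1%:M p.2)].
  by rewrite -[X in measurable X]setTI; exact: mrow.
pose slice y := [set x : 'rV[R]_n | A (row_mx y%:M x)].
have sliceE y : slice y =
    xsection [set p : measurableTypeR R * 'rV[R]_n | A (row_mx p.1%:M p.2)] y.
  by apply/seteqP; split => x /=; rewrite /xsection /= inE.
have mslice y : measurable (slice y).
  by rewrite sliceE; exact: measurable_xsection.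
have mV : measurable_fun [set: measurableTypeR R] (fun y => volume (slice y)).
  by under eq_fun do rewrite sliceE; exact: measurable_fun_xsection.
have mc : measurable_fun [set: measurableTypeR R]
   (fun y => c * y : measurableTypeR R).
  exact: mulrl_measurable.
rewrite !volumeSE.
rewrite (eq_integral (fun y : measurableTypeR R => (c^-1 ^+ n)%:E *
   volume (slice (c * y)%R)))%E; last first.
  move=> y _; rewrite -IH//; congr (volume _); apply/funext => x.
  rewrite /preimage /slice /= -scale_scalar_mx.
  by rewrite -(@scale_row_mx R 1 1 n).
rewrite ge0_integralZl_EFin//; last 2 first.
- exact: (measurableT_comp mV mc).
- by rewrite exprn_ge0 ?invr_ge0 ?ltW.
rewrite (@ge0_integral_lebesgue_scale c (fun y => volume (slice y)))//.
by rewrite muleA -EFinM -exprSr.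
Qed.

End scaling.

(** * Spherical measure *)

Section spherical.
Context {R : realType}.

Lemma measurable_dotv_self n :
  measurable_fun [set: 'rV[R]_n] (fun x : 'rV[R]_n => dotv x x : R).
Proof.
rewrite /dotv; apply: measurable_sum => i.
by apply: measurable_funM; exact: measurable_coord.
Qed.

Lemma measurable_enorm n : measurable_fun [set: 'rV[R]_n] (@enorm R n).
Proof.
rewrite /enorm; apply: (@measurableT_comp _ _ _ _ _ _ (@Num.sqrt R)).
  by apply: continuous_measurable_fun; exact: sqrt_continuous.
exact: measurable_dotv_self.
Qed.

Lemma dotvv_ge0 n (x : 'rV[R]_n) : 0 <= dotv x x.
Proof. by apply: sumr_ge0 => i _; rewrite -expr2 sqr_ge0. Qed.

Lemma enorm_ge0 n (x : 'rV[R]_n) : 0 <= enorm x.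
Proof. exact: sqrtr_ge0. Qed.

Lemma sqr_enorm n (x : 'rV[R]_n) : enorm x ^+ 2 = dotv x x.
Proof. by rewrite sqr_sqrtr ?dotvv_ge0. Qed.

Lemma coord_le_enorm n (x : 'rV[R]_n) i : `|x ord0 i| <= enorm x.
Proof.
rewrite -(@ler_pXn2r _ 2)// ?nnegrE ?enorm_ge0// sqr_enorm -normrX.
rewrite ger0_norm ?sqr_ge0// /dotv (bigD1 i)//= -expr2 lerDl.
by apply: sumr_ge0 => j _; rewrite -expr2 sqr_ge0.
Qed.

Lemma enormZ n c (x : 'rV[R]_n) : 0 <= c -> enorm (c *: x) = c * enorm x.
Proof.
move=> c0; rewrite /enorm /dotv.
under eq_bigr do rewrite !mxE mulrACA.
by rewrite -mulr_sumr sqrtrM ?mulr_ge0// -expr2 sqrtr_sqr ger0_norm.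
Qed.

Lemma normalize_sphere n (x : 'rV[R]_n) : 0 < enorm x ->
  sphere ((enorm x)^-1 *: x).
Proof.
by move=> x0; rewrite /sphere /= enormZ ?invr_ge0 ?ltW// mulVf// gt_eqF.
Qed.

Lemma measurable_normalize n :
  measurable_fun [set: 'rV[R]_n] (fun x : 'rV[R]_n => (enorm x)^-1 *: x).
Proof.
apply: measurable_fun_coordP => i; under eq_fun do rewrite mxE.
apply: measurable_funM; last exact: measurable_coord.
under eq_fun do rewrite -powR_inv1 ?enorm_ge0//.
apply: (@measurableT_comp _ _ _ _ _ _ (fun y : R => y `^ (-1))) => //.
exact: measurable_enorm.
Qed.

Lemma measurable_preimageT d (T : measurableType d) d' (U : measurableType d')
    (f : T -> U) (A : set U) :
  measurable_fun [set: T] f -> measurable A -> measurable (f @^-1` A).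
Proof. by move=> mf mA; rewrite -[X in measurable X]setTI; exact: mf. Qed.

Lemma measurable_sphere n : measurable (@sphere R n).
Proof.
rewrite (_ : @sphere R n = @enorm R n @^-1` [set 1])//.
by apply: measurable_preimageT => //; exact: measurable_enorm.
Qed.

Let punctured_ball (n : nat) : set 'rV[R]_n := [set x : 'rV[R]_n | 0 < enorm x <= 1].

Let measurable_punctured_ball n : measurable (@punctured_ball n).
Proof.
rewrite (_ : @punctured_ball n = @enorm R n @^-1` `]0, 1]%classic).
  by apply: measurable_preimageT => //; exact: measurable_enorm.
by apply/seteqP; split => x; rewrite /punctured_ball /= in_itv.
Qed.

Lemma measurable_cone n (A : set 'rV[R]_n) : measurable A ->
  measurable [set x : 'rV[R]_n | 0 < enorm x <= 1 /\ A ((enorm x)^-1 *: x)].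
Proof.
move=> mA; apply: (@measurableI _ _ (@punctured_ball n)
  ((fun x : 'rV[R]_n => (enorm x)^-1 *: x) @^-1` A)) => //.
by apply: measurable_preimageT => //; exact: measurable_normalize.
Qed.

(** Up to the factor n, this is the image under x / |x| of [volume] restricted to the punctured unit
    ball. *)
Lemma spherical_measure_ex n :
  exists mu : {measure set 'rV[R]_n -> \bar R}, @spherical_measure R n = mu.
Proof.
pose m := measure_function_pushforward__canonical__measure_function_Measure
  (mrestr (@volume R n) (@measurable_punctured_ball n)) (@measurable_normalize n).
exists (mscale (NngNum (ler0n R n)) m); apply/funext => A.
rewrite /spherical_measure /m /mscale /= /pushforward /mrestr.
congr (_ * volume _)%E.
by apply/seteqP; split => x; rewrite /punctured_ball /= => -[].
Qed.

Let spherical0 n : @spherical_measure R n set0 = 0%E.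
Proof. by have [mu ->] := spherical_measure_ex n. Qed.

Let spherical_ge0 n (A : set 'rV[R]_n) : (0 <= spherical_measure A)%E.
Proof. by have [mu ->] := spherical_measure_ex n. Qed.

Let spherical_sigma_additive n : semi_sigma_additive (@spherical_measure R n).
Proof.
by have [mu ->] := spherical_measure_ex n; exact: measure_semi_sigma_additive.
Qed.

HB.instance Definition _ n := isMeasure.Build _ _ _ (@spherical_measure R n)
  (@spherical0 n) (@spherical_ge0 n) (@spherical_sigma_additive n).

Lemma spherical_measure_lty n (A : set 'rV[R]_n) : measurable A ->
  (spherical_measure A < +oo)%E.
Proof.
(* The cone lies in the unit ball. The box around it is open at its lower end, which must therefore
   be strictly below -1; hence 2 instead of 1. *)
move=> mA; rewrite /spherical_measure lte_mul_pinfty ?lee_fin//.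
apply: (@le_lt_trans _ _ (volume (@box R n (-2) 2))).
  apply: le_measure; rewrite ?inE; [exact: measurable_cone|exact: measurable_box|].
  move=> x /= [/andP[_ x1] _] i; have := coord_le_enorm x i.
  move=> /le_trans/(_ x1); rewrite ler_norml => /andP[h1 h2].
  by rewrite (lt_le_trans _ h1) ?(le_trans h2)// ?ltrN2 ?ler1n ?ltr1n.
by rewrite volume_box ?ltry// -subr_ge0 opprK addr_ge0.
Qed.

(** The cone over A lies in the dilate d P, whose volume is d^n times that of P. *)
Lemma spherical_measure_le_volume n (d : R) (A P : set 'rV[R]_n) : 0 < d ->
  measurable A -> measurable P ->
  (forall x, 0 < enorm x <= 1 -> A ((enorm x)^-1 *: x) -> P (d^-1 *: x)) ->
  (spherical_measure A <= (n%:R * d ^+ n)%:E * volume P)%E.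
Proof.
move=> d0 mA mP AP; rewrite /spherical_measure EFinM -muleA lee_wpmul2l ?lee_fin//.
rewrite -[in leRHS](invrK d) -volume_scale ?invr_gt0//.
apply: le_measure; rewrite ?inE; first exact: measurable_cone.
  by apply: measurable_preimageT => //; exact: measurable_scale.
by move=> x /= [x1 Ax]; exact: AP.
Qed.

Lemma spherical_measure_sphere_gt0 n : (0 < n)%N ->
  (0 < spherical_measure (@sphere R n))%E.
Proof.
move=> n0; have n0' : 0 < n%:R :> R by rewrite ltr0n.
rewrite /spherical_measure mule_gt0 ?lte_fin//.
(* Coordinates in this box are positive and at most 1/n <= 1, so their squares are at most 1/n and
   the Euclidean norm is at most 1; the positive lower end keeps the box off the origin. *)
apply: (@lt_le_trans _ _ (volume (@box R n ((2 * n%:R)^-1) (n%:R^-1)))).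
  have h : (2 * n%:R)^-1 < n%:R^-1 :> R.
    by rewrite ltf_pV2 ?posrE ?mulr_gt0// ltr_pMl// ltr1n.
  by rewrite volume_box ?ltW// lte_fin exprn_gt0// subr_gt0.
apply: le_measure; rewrite ?inE; first exact: measurable_box.
  by apply: measurable_cone; exact: measurable_sphere.
move=> x bx /=; have x0 : 0 < enorm x.
  have := bx (Ordinal n0) => /andP[h _].
  apply: lt_le_trans (coord_le_enorm x (Ordinal n0)).
  by rewrite gtr0_norm (lt_trans _ h)// invr_gt0 mulr_gt0.
split; last exact: normalize_sphere.
rewrite x0 /= -(@ler_pXn2r _ 2)// ?nnegrE ?enorm_ge0// sqr_enorm expr1n.
apply: (@le_trans _ _ (\sum_(i < n) (n%:R^-1 : R))); last first.
  by rewrite sumr_const card_ord -[leLHS]mulr_natl divff ?gt_eqF.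
apply: ler_sum => i _; have /andP[h1 h2] := bx i.
have xi0 : 0 < x ord0 i by rewrite (lt_trans _ h1)// invr_gt0 mulr_gt0.
apply: le_trans h2; rewrite ger_pMl// (le_trans (andP (bx i)).2)//.
by rewrite invf_le1// ler1n.
Qed.

End spherical.

(** * Support functions and polar bodies *)

Section convex_bodies.
Context {R : realType} {n : nat}.
Implicit Types (L A : set 'rV[R]_n) (u x y : 'rV[R]_n).

(** This links the topology with the sigma-algebra generated by the coordinates: an open set is a
    union of open cubes with rational centres and sides 2/(k + 1), and there are only countably many
    of these. *)
Lemma open_measurable_row A : open A -> measurable A.
Proof.
move=> oA.
pose B (q : 'rV[rat]_n) (k : nat) : set 'rV[R]_n :=
  [set x | forall i, `|x ord0 i - ratr (q ord0 i)| < k.+1%:R^-1].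
have mB q k : measurable (B q k).
  rewrite (_ : B q k = \big[setI/setT]_(i < n)
      ((fun x : 'rV[R]_n => x ord0 i : R) @^-1` ball (ratr (q ord0 i) : R) k.+1%:R^-1)).
    apply: bigsetI_measurable => i _.
    apply: measurable_preimageT; first exact: measurable_coord.
    exact: measurable_ball.
  apply/seteqP; split => [x bx|x].
    by rewrite -bigcap_seq => i _ /=; rewrite /ball /= distrC; exact: bx.
  rewrite -bigcap_seq => bx i; have := bx i (mem_index_enum i).
  by rewrite /= /ball /= distrC.
pose F (qk : 'rV[rat]_n * nat) :=
  if `[< B qk.1 qk.2 `<=` A >] then B qk.1 qk.2 else set0.
suff -> : A = \bigcup_qk F qk.
  apply: countable_bigcupT_measurable => [|qk]; first exact: countableP.
  by rewrite /F; case: ifPn.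
apply/seteqP; split => [x Ax|x [qk _]]; last first.
  by rewrite /F; case: ifPn => // /asboolP; apply.
have /nbhs_ballP[e /= e0 eA] : nbhs x A by exact: open_nbhs_nbhs.
(* Two points of one cube differ by less than 2/(k + 1) in each coordinate. *)
pose k := Num.truncn (2 / e); have ke : 2 / k.+1%:R < e.
  by rewrite ltr_pdivrMr// mulrC -ltr_pdivrMr// truncnS_gt.
have k0 : 0 < k.+1%:R^-1 :> R by rewrite invr_gt0.
have qP i : exists q : rat, `|x ord0 i - ratr q| < k.+1%:R^-1.
  have : x ord0 i - k.+1%:R^-1 < x ord0 i + k.+1%:R^-1.
    by rewrite ltrBlDr -addrA ltrDl addr_gt0.
  move=> /rat_in_itvoo[q]; rewrite in_itv /= => /andP[q1 q2]; exists q.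
  by rewrite distrC ltr_distl q1 q2.
pose q := \row_i sval (cid (qP i)).
have qE i : `|x ord0 i - ratr (q ord0 i)| < k.+1%:R^-1.
  by rewrite mxE; case: cid.
exists (q, k) => //; rewrite /F ifT//=; apply/asboolP => y By; apply: eA.
split => // i j; rewrite ord1 /ball /=.
rewrite (le_lt_trans (ler_distD (ratr (q ord0 j)) _ _))// (lt_trans _ ke)//.
by rewrite [2 / _]mulrC mulr_natr mulr2n ltrD// distrC.
Qed.

Lemma K0_outer L : K0 L -> exists2 M, 0 < M & forall x i, L x -> `|x ord0 i| <= M.
Proof.
move=> [cL _ _].
have mx i : exists M, forall x, L x -> `|x ord0 i| <= M.
  have : compact ((fun x : 'rV[R]_n => x ord0 i) @` L).
    apply: continuous_compact => //; apply: continuous_subspaceT => x.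
    exact: coord_continuous.
  move=> /compact_bounded[M [_ +]] => /(_ (M + 1)); rewrite ltrDl ltr01 => /(_ isT) h.
  by exists (M + 1) => x Lx; apply: h; exists x.
pose M i := sval (cid (mx i)).
exists (\sum_i `|M i| + 1); first by rewrite ltr_wpDl// sumr_ge0.
move=> x i Lx; apply: (@le_trans _ _ `|M i|).
  by rewrite (le_trans _ (ler_norm _))// /M; case: cid => /= ? ; apply.
by rewrite (bigD1 i)//= -addrA lerDl addr_ge0// sumr_ge0.
Qed.

Lemma K0_inner L : K0 L ->
  exists2 e, 0 < e & forall x, (forall i, `|x ord0 i| <= e) -> L x.
Proof.
move=> [_ _ /nbhs_ballP[e /= e0 eL]]; exists (e / 2); first by rewrite divr_gt0.
move=> x xe; apply: eL; split => // i j; rewrite ord1 /ball /= mxE sub0r normrN.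
by rewrite (le_lt_trans (xe j))// ltr_pdivrMr// ltr_pMr// ltr1n.
Qed.

Lemma sphere_coord u i : sphere u -> `|u ord0 i| <= 1.
Proof. by move=> <-; exact: coord_le_enorm. Qed.

Lemma dotvZl c x y : dotv (c *: x) y = c * dotv x y.
Proof. by rewrite /dotv mulr_sumr; apply: eq_bigr => i _; rewrite mxE mulrA. Qed.

Lemma dotvC x y : dotv x y = dotv y x.
Proof. by apply: eq_bigr => i _; rewrite mulrC. Qed.

Lemma dotvv_sphere u : sphere u -> dotv u u = 1.
Proof. by move=> u1; rewrite -sqr_enorm u1 expr1n. Qed.

Lemma dotv_le (a b : R) x y : (forall i, `|x ord0 i| <= a) ->
  (forall i, `|y ord0 i| <= b) -> dotv x y <= n%:R * (a * b).
Proof.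
move=> xa yb; rewrite mulr_natl -[n in leRHS]card_ord -sumr_const.
apply: ler_sum => i _; rewrite (le_trans (ler_norm _))// normrM.
by rewrite ler_pM.
Qed.

Lemma K0_has_sup L u : K0 L -> has_sup [set dotv x u | x in L].
Proof.
move=> KL; split.
  have [e e0 eL] := K0_inner KL; exists (dotv 0 u); exists 0 => //.
  by apply: eL => i; rewrite mxE normr0 ltW.
have [M M0 LM] := K0_outer KL.
exists (n%:R * (M * \sum_i `|u ord0 i|)) => _ [x Lx <-].
apply: dotv_le => i; first exact: LM.
by rewrite (bigD1 i)//= lerDl sumr_ge0.
Qed.

Lemma support_function_ge L x u : K0 L -> L x -> dotv x u <= support_function L u.
Proof.
move=> KL Lx; apply: ub_le_sup; first by have [] := K0_has_sup u KL.
by exists x.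
Qed.

Lemma support_function_le L u c : K0 L -> (forall x, L x -> dotv x u <= c) ->
  support_function L u <= c.
Proof.
move=> KL Lc; apply: ge_sup; first by have [] := K0_has_sup u KL.
by move=> _ [x Lx <-]; exact: Lc.
Qed.

Lemma support_function_bounds L : K0 L -> exists m M, 0 < m /\
  forall u, sphere u -> m <= support_function L u <= M.
Proof.
move=> KL; have [e e0 eL] := K0_inner KL; have [M M0 LM] := K0_outer KL.
exists e, (n%:R * (M * 1)); split => // u u1; apply/andP; split.
  (* The point e u lies in the cube inside L and has scalar product e with u. *)
  rewrite -[e]mulr1 -(dotvv_sphere u1) -dotvZl support_function_ge//.
  apply: eL => i; rewrite mxE normrM gtr0_norm// ler_piMr ?(ltW e0)//.
  exact: sphere_coord.
apply: support_function_le => // x Lx; apply: dotv_le => i; first exact: LM.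
exact: sphere_coord.
Qed.

Lemma continuous_dotv x : continuous (dotv x).
Proof.
apply: continuous_big => [|i _ y]; first exact: add_continuous.
apply: continuousM; last exact: coord_continuous.
exact: cst_continuous.
Qed.

(** A supremum of linear functions is lower semicontinuous: its strict superlevel sets are unions of
    open sets. *)
Lemma measurable_support_function L : K0 L ->
  measurable_fun [set: 'rV[R]_n] (support_function L).
Proof.
move=> KL; apply: (measurability _ (RGenOInfty.measurableE R)) => //.
move=> /= _ [_ [c ->]] <-; rewrite setTI; apply: open_measurable_row.
rewrite (_ : _ @^-1` _ = \bigcup_(x in L) (dotv x @^-1` `]c, +oo[)).
  apply: bigcup_open => x Lx; apply: open_comp => [y _|].
    exact: continuous_dotv.
  exact: interval_open.
apply/seteqP; split => u /=; rewrite ?in_itv /= ?andbT.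
  move=> /sup_gt[|_ [x Lx <-] h]; first by have [] := K0_has_sup u KL.
  by exists x => //=; rewrite in_itv /= andbT.
move=> [x Lx] /=; rewrite !in_itv /= !andbT => h.
by rewrite (lt_le_trans h)// support_function_ge.
Qed.

Lemma measurable_polar L : measurable (polar L).
Proof.
rewrite -[polar L]setCK; apply: measurableC; apply: open_measurable_row.
rewrite (_ : ~` _ = \bigcup_(x in L) (dotv x @^-1` `]1, +oo[)).
  apply: bigcup_open => x Lx; apply: open_comp => [y _|].
    exact: continuous_dotv.
  exact: interval_open.
apply/seteqP; split => u /=.
  move=> /existsNP[x /not_implyP[Lx /negP]]; rewrite -ltNge => h.
  by exists x => //=; rewrite in_itv /= andbT dotvC.
move=> [x Lx] /=; rewrite in_itv /= andbT => h /(_ _ Lx).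
by rewrite dotvC leNgt h.
Qed.

Lemma volume_polar_lty L : K0 L -> (volume (polar L) < +oo)%E.
Proof.
move=> KL; have [e e0 eL] := K0_inner KL.
apply: (@le_lt_trans _ _ (volume (@box R n (- (2 * e^-1)) (2 * e^-1)))); last first.
  by rewrite volume_box ?ltry// -subr_ge0 opprK addr_ge0// mulr_ge0 ?invr_ge0// ltW.
apply: le_measure; rewrite ?inE; [exact: measurable_polar|exact: measurable_box|].
move=> x px i.
suff : `|x ord0 i| <= e^-1.
  have ei : e^-1 < 2 * e^-1 by rewrite ltr_pMl ?invr_gt0// ltr1n.
  move=> /le_lt_trans/(_ ei); rewrite ltr_norml => /andP[-> h]; exact: ltW.
(* Testing x against e times the signed i-th unit vector, a point of L, gives e |x_i| <= 1. *)
pose y : 'rV[R]_n := \row_j (if j == i then Num.sg (x ord0 i) * e else 0).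
have /px : L y.
  apply: eL => j; rewrite mxE; case: eqP => _; last by rewrite normr0 ltW.
  rewrite normrM normr_sg gtr0_norm//.
  by case: eqP => _; rewrite ?mul1r ?mul0r// ltW.
rewrite /dotv (bigD1 i)//= big1 ?addr0; last first.
  by move=> j ji; rewrite mxE (negbTE ji) mulr0.
by rewrite mxE eqxx mulrA [_ * Num.sg _]mulrC -normrEsg -ler_pdivlMr// mul1r.
Qed.

Lemma volume_polar_gt0 L : K0 L -> (0 < volume (polar L))%E.
Proof.
move=> KL; have [M M0 LM] := K0_outer KL.
(* Chosen so that n c M <= 1; the factor n + 1 keeps c positive in dimension 0 as well. *)
pose c := (n.+1%:R * M)^-1; have c0 : 0 < c by rewrite invr_gt0 mulr_gt0.
apply: (@lt_le_trans _ _ (volume (@box R n 0 c))).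
  by rewrite volume_box ?ltW// subr0 lte_fin exprn_gt0.
apply: le_measure; rewrite ?inE; [exact: measurable_box|exact: measurable_polar|].
move=> x bx y Ly.
apply: (@le_trans _ _ (n%:R * (c * M))).
  apply: dotv_le => i; last exact: LM.
  by have /andP[h1 h2] := bx i; rewrite gtr0_norm.
rewrite /c invfM mulrA -[leLHS]mulrA -mulrA mulVf ?gt_eqF// mulr1.
by rewrite ler_pdivrMr// mul1r ler_nat.
Qed.

Lemma radial_function_polar L u : K0 L -> sphere u ->
  radial_function (polar L) u = (support_function L u)^-1.
Proof.
move=> KL u1; have [m [M [m0 hL]]] := support_function_bounds KL.
have /andP[hm _] := hL u u1; have h0 := lt_le_trans m0 hm.
apply/eqP; rewrite eq_le /radial_function; apply/andP; split.
  apply: ge_sup; first by exists 0; split => // y _; rewrite dotvZl mul0r.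
  move=> c [c0 pc]; rewrite -[leRHS]mul1r ler_pdivlMr//.
  have [->|cn0] := eqVneq c 0; first by rewrite mul0r.
  have {cn0} {}c0 : 0 < c by rewrite lt_def cn0.
  rewrite mulrC -ler_pdivlMr// mul1r; apply: support_function_le => // x Lx.
  by rewrite -[leRHS]mul1r ler_pdivlMr// mulrC dotvC -dotvZl; exact: pc.
apply: ub_le_sup.
  exists (m^-1) => c [c0 pc]; rewrite -[leRHS]mul1r ler_pdivlMr//.
  have [->|cn0] := eqVneq c 0; first by rewrite mul0r.
  have {cn0} {}c0 : 0 < c by rewrite lt_def cn0.
  rewrite (@le_trans _ _ (c * support_function L u)) ?ler_pM2l//.
  rewrite mulrC -ler_pdivlMr// mul1r; apply: support_function_le => // x Lx.
  by rewrite -[leRHS]mul1r ler_pdivlMr// mulrC dotvC -dotvZl; exact: pc.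
split; first by rewrite invr_ge0 ltW.
move=> y Ly; rewrite dotvZl mulrC ler_pdivrMr// mul1r dotvC.
exact: support_function_ge.
Qed.

(* The cone of radius 1/d over the part of the sphere where h_L <= d lies in
   the polar body. *)
Lemma spherical_measure_support_le L (d : R) : K0 L -> 0 < d ->
  (spherical_measure (@sphere R n `&` [set u | (support_function L u <= d)%R]) <=
   (n%:R * d ^+ n)%:E * volume (polar L))%E.
Proof.
move=> KL d0; apply: spherical_measure_le_volume => //.
- apply: measurableI; first exact: measurable_sphere.
  rewrite (_ : [set _ | _] = support_function L @^-1` `]-oo, d]).
    by apply: measurable_preimageT => //; exact: measurable_support_function.
  by apply/seteqP; split => u; rewrite /= in_itv.
- exact: measurable_polar.
move=> x /andP[x0 x1] [_ /= hd] y Ly.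
rewrite dotvZl mulrC ler_pdivrMr// mul1r.
have := le_trans (support_function_ge ((enorm x)^-1 *: x) KL Ly) hd.
rewrite dotvC dotvZl mulrC ler_pdivrMr// => /le_trans; apply.
by rewrite ger_pMr.
Qed.

End convex_bodies.

(** * Weighted moments *)

Section powR_facts.
Context {R : realType}.

Lemma weighted_AMGM (a b l m : R) : 0 <= a -> 0 <= b -> 0 < l -> 0 < m ->
  l + m = 1 -> a `^ l * b `^ m <= l * a + m * b.
Proof.
move=> a0 b0 l0 m0 lm.
have := @conjugate_powR R (a `^ l) (b `^ m) l^-1 m^-1 (powR_ge0 _ _) (powR_ge0 _ _).
rewrite !invr_gt0 !invrK -!powRrM !divff ?gt_eqF// !powRr1//.
by move=> /(_ l0 m0 lm); rewrite mulrC ![_ * l]mulrC ![_ * m]mulrC [X in X <= _]mulrC.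
Qed.

(** Young's inequality for x / A and y / B, multiplied by A^l B^m. When A and B are the integrals of
    x and y, integrating it gives Hoelder's inequality. *)
Lemma scaled_AMGM (A B x y l m : R) : 0 < A -> 0 < B -> 0 <= x -> 0 <= y ->
  0 < l -> 0 < m -> l + m = 1 ->
  x `^ l * y `^ m <= A `^ l * B `^ m * l / A * x + A `^ l * B `^ m * m / B * y.
Proof.
move=> A0 B0 x0 y0 l0 m0 lm.
have xA0 : 0 <= x / A by rewrite divr_ge0// ltW.
have yB0 : 0 <= y / B by rewrite divr_ge0// ltW.
have xl : x `^ l = A `^ l * (x / A) `^ l.
  by rewrite -powRM ?(ltW A0)// mulrC divfK ?lt0r_neq0.
have ym : y `^ m = B `^ m * (y / B) `^ m.
  by rewrite -powRM ?(ltW B0)// mulrC divfK ?lt0r_neq0.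
have c0 : 0 <= A `^ l * B `^ m by rewrite mulr_ge0 ?powR_ge0.
rewrite xl ym mulrACA.
apply: (le_trans (ler_wpM2l c0 (weighted_AMGM xA0 yB0 l0 m0 lm))).
by rewrite mulrDr !mulrA ![_ * l * x * _]mulrAC ![_ * m * y * _]mulrAC.
Qed.

Lemma powR_bounds (m M p : R) : 0 < m -> m <= M -> exists2 c, 0 < c &
  exists2 C, 0 < C & forall x, m <= x <= M -> c <= x `^ p <= C.
Proof.
move=> m0 mM; have M0 := lt_le_trans m0 mM.
have [p0|p0] := leP 0 p.
  exists (m `^ p); first exact: powR_gt0.
  exists (M `^ p); first exact: powR_gt0.
  move=> x /andP[mx xM]; have x0 := lt_le_trans m0 mx.
  by rewrite !ge0_ler_powR// nnegrE ltW.
have p0' : 0 <= - p by rewrite oppr_ge0 ltW.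
exists (M `^ p); first exact: powR_gt0.
exists (m `^ p); first exact: powR_gt0.
move=> x /andP[mx xM]; have x0 := lt_le_trans m0 mx.
rewrite -[p]opprK !(powRN _ (- p)) !lef_pV2 ?posrE ?powR_gt0//.
by rewrite !ge0_ler_powR// nnegrE ltW.
Qed.

Lemma powR_prod (I : Type) (s : seq I) (F : I -> R) (p : R) :
  (forall i, 0 <= F i) ->
  (\prod_(i <- s) F i) `^ p = \prod_(i <- s) F i `^ p.
Proof.
move=> F0; elim: s => [|i s IH]; first by rewrite !big_nil powR1.
by rewrite !big_cons powRM ?IH// prodr_ge0.
Qed.

Lemma prod_powR_invn (n : nat) (x : R) : (0 < n)%N -> 0 <= x ->
  \prod_(i < n) x `^ n%:R^-1 = x.
Proof.
move=> n0 x0; rewrite prodr_const card_ord -powR_mulrn ?powR_ge0// -powRrM.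
by rewrite mulVf ?powRr1// pnatr_eq0 -lt0n.
Qed.

End powR_facts.

Section weighted_moments.
Context d (T : measurableType d) (R : realType).
Variables (mu : {measure set T -> \bar R}) (D : set T) (mD : measurable D).
Variable phi : T -> R.
Hypothesis phi0 : forall x, D x -> 0 <= phi x.
Hypothesis iphi : mu.-integrable D (EFin \o phi).

Let mphi : measurable_fun D phi.
Proof. exact/measurable_EFinP/(measurable_int mu). Qed.

Definition moment (q : T -> R) (p : R) : \bar R :=
  (\int[mu]_(x in D) (phi x * q x `^ p)%:E)%E.

(** The bounds pass to q^p for every real p, of either sign. Hence all moments are finite, and they
    are positive as soon as the integral of [phi] is. *)
Definition comparable_to_one (q : T -> R) := measurable_fun D q /\
  exists m M, 0 < m /\ forall x, D x -> m <= q x <= M.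

Lemma comparable_powR q p : comparable_to_one q -> exists2 c, 0 < c &
  exists2 C, 0 < C & forall x, D x -> c <= q x `^ p <= C.
Proof.
move=> [mq [m [M [m0 qmM]]]].
have [mM|Mm] := leP m M.
  have [c c0 [C C0 cC]] := powR_bounds p m0 mM; exists c => //; exists C => // x Dx.
  exact/cC/qmM.
(* Here M < m, so D is empty and any constants do. *)
exists 1 => //; exists 1 => // x Dx; have /andP[h1 h2] := qmM _ Dx.
by have := lt_le_trans Mm (le_trans h1 h2); rewrite ltxx.
Qed.

Lemma measurable_moment q p : comparable_to_one q ->
  measurable_fun D (fun x => (phi x * q x `^ p)%:E).
Proof.
move=> [mq _]; apply/measurable_EFinP; apply: measurable_funM => //.
exact: (measurableT_comp (measurable_powR p)).
Qed.

Lemma moment_ge0 q p : (0 <= moment q p)%E.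
Proof. by apply: integral_ge0 => x Dx; rewrite lee_fin mulr_ge0 ?phi0 ?powR_ge0. Qed.

Lemma moment_bounds q p : comparable_to_one q -> exists2 c, 0 < c &
  exists2 C, 0 < C & (c%:E * \int[mu]_(x in D) (phi x)%:E <= moment q p
    <= C%:E * \int[mu]_(x in D) (phi x)%:E)%E.
Proof.
move=> cq; have [c c0 [C C0 cC]] := comparable_powR p cq.
exists c => //; exists C => //.
have mphi' : measurable_fun D (fun x => (phi x)%:E) by exact/measurable_EFinP.
have phi0' x : D x -> (0 <= (phi x)%:E)%E by move=> Dx; rewrite lee_fin phi0.
rewrite -!ge0_integralZl_EFin ?(ltW c0) ?(ltW C0)//.
apply/andP; split; apply: ge0_le_integral => //.
- by move=> x Dx; rewrite mule_ge0 ?lee_fin ?phi0// ltW.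
- by apply: measurable_funeM.
- exact: measurable_moment.
- move=> x Dx; rewrite -EFinM lee_fin mulrC ler_wpM2l ?phi0//.
  by case/andP: (cC x Dx).
- by move=> x Dx; rewrite lee_fin mulr_ge0 ?phi0 ?powR_ge0.
- exact: measurable_moment.
- by apply: measurable_funeM.
- move=> x Dx; rewrite -EFinM lee_fin [leRHS]mulrC ler_wpM2l ?phi0//.
  by case/andP: (cC x Dx).
Qed.

Let Iphi := (\int[mu]_(x in D) (phi x)%:E)%E.

Let Iphi_lty : (Iphi < +oo)%E.
Proof. exact: integrable_lty iphi. Qed.

Let Iphi_ge0 : (0 <= Iphi)%E.
Proof. by apply: integral_ge0 => x Dx; rewrite lee_fin phi0. Qed.

Lemma moment_eq0 q p : comparable_to_one q -> Iphi = 0%E -> moment q p = 0%E.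
Proof.
move=> /(moment_bounds p)[c _ [C _]]; rewrite -/Iphi => + I0; rewrite I0 !mule0.
by move=> h; apply/eqP; rewrite eq_le andbC.
Qed.

Lemma moment_lty q p : comparable_to_one q -> (moment q p < +oo)%E.
Proof.
move=> /(moment_bounds p)[c _ [C C0 /andP[_]]] /le_lt_trans; apply.
by rewrite lte_mul_pinfty ?lee_fin ?ltW.
Qed.

Lemma moment_gt0 q p : comparable_to_one q -> (0 < Iphi)%E -> (0 < moment q p)%E.
Proof.
move=> /(moment_bounds p)[c c0 [C _ /andP[+ _]]] I0; apply: lt_le_trans.
by rewrite mule_gt0 ?lte_fin.
Qed.

Lemma fineK_moment q p : comparable_to_one q -> (fine (moment q p))%:E = moment q p.
Proof. by move=> cq; rewrite fineK// ge0_fin_numE ?moment_ge0// moment_lty. Qed.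

(** Hoelder's inequality with exponents 1/l and 1/m: [scaled_AMGM] is integrated with A and B the
    two moments, and the right-hand side becomes (l + m) A^l B^m. *)
Let moment_log_convex_pos q r s t l m (A B : R) : comparable_to_one q ->
  0 < l -> 0 < m -> l + m = 1 -> r = l * s + m * t ->
  A%:E = moment q s -> B%:E = moment q t -> 0 < A -> 0 < B ->
  (moment q r <= (A `^ l * B `^ m)%:E)%E.
Proof.
move=> cq l0 m0 lm rE AE BE A0 B0; pose c := A `^ l * B `^ m.
have cA0 : 0 <= c * l / A.
  by rewrite divr_ge0 ?(ltW A0)// mulr_ge0 ?(ltW l0)// mulr_ge0 ?powR_ge0.
have cB0 : 0 <= c * m / B.
  by rewrite divr_ge0 ?(ltW B0)// mulr_ge0 ?(ltW m0)// mulr_ge0 ?powR_ge0.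
have q0 x : D x -> 0 < q x.
  by case: cq => _ [m' [M' [m'0 +]]] Dx => /(_ _ Dx)/andP[/(lt_le_trans m'0)].
have F0 p x : D x -> (0 <= (phi x * q x `^ p)%:E)%E.
  by move=> Dx; rewrite lee_fin mulr_ge0 ?phi0 ?powR_ge0.
have mF p := measurable_moment p cq.
apply: (@le_trans _ _ (\int[mu]_(x in D) ((c * l / A)%:E * (phi x * q x `^ s)%:E +
    (c * m / B)%:E * (phi x * q x `^ t)%:E))%E).
  apply: ge0_le_integral => //.
  - exact: F0.
  - by apply: emeasurable_funD; apply: measurable_funeM.
  move=> x Dx; rewrite -!EFinM -EFinD lee_fin.
  have px := phi0 Dx.
  have -> : phi x * q x `^ r = (phi x * q x `^ s) `^ l * (phi x * q x `^ t) `^ m.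
    rewrite !powRM ?powR_ge0// -!powRrM mulrACA -powRD; last by rewrite lm oner_eq0.
    rewrite -powRD; last by apply/implyP => _; rewrite gt_eqF ?q0.
    by rewrite lm powRr1// rE ![_ * l]mulrC ![_ * m]mulrC.
  by apply: scaled_AMGM => //; rewrite mulr_ge0 ?powR_ge0.
rewrite ge0_integralD//; last 4 first.
- by move=> x Dx; rewrite mule_ge0 ?F0 ?lee_fin.
- exact: measurable_funeM.
- by move=> x Dx; rewrite mule_ge0 ?F0 ?lee_fin.
- exact: measurable_funeM.
rewrite !ge0_integralZl_EFin//; [|exact: F0..].
rewrite -[X in (_ * X + _)%E]/(moment q s) -[X in (_ + _ * X)%E]/(moment q t).
rewrite -BE -AE -!EFinM -EFinD lee_fin.
by rewrite !divfK ?lt0r_neq0// -mulrDr lm mulr1.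
Qed.

Lemma moment_log_convex q r s t l m : comparable_to_one q -> (0 < Iphi)%E ->
  0 < l -> 0 < m -> l + m = 1 -> r = l * s + m * t ->
  fine (moment q r) <= fine (moment q s) `^ l * fine (moment q t) `^ m.
Proof.
move=> cq I0 l0 m0 lm rE; rewrite -lee_fin fineK_moment//.
have gt0 p : 0 < fine (moment q p).
  by rewrite fine_gt0// moment_gt0//= moment_lty.
by apply: (moment_log_convex_pos cq l0 m0 lm rE) => //; rewrite fineK_moment.
Qed.

(** If all the sets where [phi] >= 1/(k + 1) were null, their union would be null and [phi] would
    vanish almost everywhere. *)
Lemma moment_gt0_superlevel : (0 < Iphi)%E -> exists2 e, 0 < e &
  measurable (D `&` [set x | (e <= phi x)%R]) /\
  (0 < mu (D `&` [set x | (e <= phi x)%R]))%E.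
Proof.
move=> I0; pose A k := D `&` [set x | (k.+1%:R^-1 <= phi x)%R].
have mA k : measurable (A k).
  rewrite (_ : A k = D `&` phi @^-1` `[k.+1%:R^-1, +oo[); first exact: mphi.
  by apply/seteqP; split => x; rewrite /A /= in_itv /= andbT.
have [[k muA]|noA] := pselect (exists k, (0 < mu (A k))%E).
  by exists k.+1%:R^-1; rewrite ?invr_gt0//; split => //; exact: mA.
suff : Iphi = 0%E by move=> E; rewrite E ltxx in I0.
have mUA : measurable (\bigcup_k A k) by exact: bigcupT_measurable.
have A0 : mu (\bigcup_k A k) = 0%E.
  apply: measure_negligible => //; apply: negligible_bigcup => k.
  apply/negligibleP => //; apply/eqP; rewrite eq_le measure_ge0 andbT leNgt.
  by apply/negP => h; apply: noA; exists k.
have mphi' : measurable_fun D (fun x => (phi x)%:E) by exact/measurable_EFinP.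
rewrite /Iphi (ge0_negligible_integral mUA mD mphi' _ A0); last first.
  by move=> x Dx; rewrite lee_fin phi0.
apply: integral0_eq => x [Dx nA]; apply/eqP; rewrite eqe eq_le phi0// andbT leNgt.
apply/negP => px; apply: nA; exists (Num.truncn (phi x)^-1) => //; split => //=.
rewrite -[leRHS]invrK lef_pV2 ?posrE ?invr_gt0// ltW// truncnS_gt//.
Qed.

(** Chebyshev's inequality: only the integral over B is kept, where the integrand is at least e
    eta^p. *)
Lemma moment_lower_bound q p (e eta : R) (B : set T) :
  comparable_to_one q -> 0 <= p -> 0 <= e -> 0 <= eta -> measurable B ->
  (forall x, B x -> [/\ D x, e <= phi x & eta <= q x]) ->
  ((e * eta `^ p)%:E * mu B <= moment q p)%E.
Proof.
move=> cq p0 e0 eta0 mB hB.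
have BD : B `<=` D by move=> x /hB[].
apply: (@le_trans _ _ (\int[mu]_(x in B) (phi x * q x `^ p)%:E)%E).
  rewrite -integral_cst//; apply: ge0_le_integral => //.
  - by move=> x _; rewrite lee_fin mulr_ge0 ?powR_ge0.
  - by apply: measurable_funS (measurable_moment p cq).
  - move=> x /hB[_ ephi etaq]; rewrite lee_fin ler_pM ?powR_ge0//.
    by rewrite ge0_ler_powR// nnegrE// (le_trans _ etaq).
apply: ge0_subset_integral => //; first exact: measurable_moment.
by move=> x Dx; rewrite lee_fin mulr_ge0 ?phi0 ?powR_ge0.
Qed.

End weighted_moments.

(** * Mixed volumes *)

Section comparable.
Context d (T : measurableType d) (R : realType) (D : set T).
Implicit Types f g : T -> R.

Lemma comparable_to_oneM f g : comparable_to_one D f -> comparable_to_one D g ->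
  comparable_to_one D (fun x => f x * g x).
Proof.
move=> [mf [a [A [a0 fA]]]] [mg [b [B [b0 gB]]]]; split; first exact: measurable_funM.
exists (a * b), (A * B); split => [|x Dx]; first exact: mulr_gt0.
have /andP[f1 f2] := fA x Dx; have /andP[g1 g2] := gB x Dx.
have f0 := lt_le_trans a0 f1; have g0 := lt_le_trans b0 g1.
by rewrite !ler_pM// ltW.
Qed.

Lemma comparable_to_oneV f : comparable_to_one D f ->
  comparable_to_one D (fun x => (f x)^-1).
Proof.
move=> [mf [a [A [a0 fA]]]]; split.
  apply: (@eq_measurable_fun _ _ _ _ D (fun x => f x `^ (-1))).
    move=> x; rewrite inE => /fA/andP[f1 _].
    by rewrite powR_inv1// (le_trans _ f1)// ltW.
  exact: (measurableT_comp (measurable_powR (-1))).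
(* A is known to be positive only when D is nonempty, so |A| + 1 replaces it. *)
have A0 : 0 < `|A| + 1 by rewrite ltr_wpDl.
exists (`|A| + 1)^-1, a^-1; split; first by rewrite invr_gt0.
move=> x /fA/andP[f1 f2]; have f0 := lt_le_trans a0 f1.
rewrite !lef_pV2 ?posrE// f1 andbT (le_trans f2)// (le_trans (ler_norm _))//.
by rewrite lerDl.
Qed.

Lemma comparable_to_one1 : comparable_to_one D (fun=> 1 : R).
Proof.
split; first exact: measurable_cst.
by exists 1, 1; split => // x _; rewrite lexx.
Qed.

Lemma comparable_to_one_prod (I : Type) (s : seq I) (f : I -> T -> R) :
  (forall i, comparable_to_one D (f i)) ->
  comparable_to_one D (fun x => \prod_(i <- s) f i x).
Proof.
move=> cf; elim: s => [|i s IH].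
  by under eq_fun do rewrite big_nil; exact: comparable_to_one1.
by under eq_fun do rewrite big_cons; exact: comparable_to_oneM.
Qed.

Lemma comparable_to_one_gt0 f x : comparable_to_one D f -> D x -> 0 < f x.
Proof. by move=> [_ [a [A [a0 +]]]] Dx => /(_ _ Dx)/andP[/(lt_le_trans a0)]. Qed.
End comparable.

Lemma measure_bigsetU_le d (T : measurableType d) (R : realType)
    (mu : {measure set T -> \bar R}) (I : Type) (r : seq I) (B : I -> set T) :
  (forall i, measurable (B i)) ->
  (mu (\big[setU/set0]_(i <- r) B i) <= \sum_(i <- r) mu (B i))%E.
Proof.
move=> mB; elim: r => [|i r IH]; first by rewrite !big_nil measure0.
rewrite !big_cons (le_trans (measureU2 _ _ _))//.
  exact: bigsetU_measurable.
by rewrite leeD2l.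
Qed.

Lemma powR_scale_log_convex (R : realType) (c x y z x' y' z' l m : R) :
  x' = c * x -> y' = c * y -> z' = c * z -> 0 <= c ->
  0 <= y -> 0 <= z -> l + m = 1 -> x <= y `^ l * z `^ m ->
  x' <= y' `^ l * z' `^ m.
Proof.
move=> -> -> -> c0 y0 z0 lm xyz; rewrite !powRM// mulrACA -powRD; last by rewrite lm oner_eq0.
by rewrite lm powRr1// ler_wpM2l.
Qed.

Section mixed_volumes.
Context {R : realType} {n : nat} (n0 : (0 < n)%N).
Local Notation sigma := (@spherical_measure R n).
Local Notation S := (@sphere R n).
Let mS : measurable S := @measurable_sphere R n.
Implicit Type L : 'I_n -> set 'rV[R]_n.

Lemma comparable_support_function (L : set 'rV[R]_n) : K0 L ->
  comparable_to_one S (support_function L).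
Proof.
move=> KL; split.
  by apply: measurable_funS (measurable_support_function KL).
have [m [M [m0 hM]]] := support_function_bounds KL.
by exists m, M.
Qed.

Variable K : 'I_n -> set 'rV[R]_n.
Hypothesis hK : forall i, F0 (K i).

Let K0K i : K0 (K i). Proof. by case: (hK i). Qed.

Let curvatureP i : is_curvature_function (K i) (curvature_function (K i)).
Proof.
rewrite /curvature_function; apply: (@xgetPex _ _ (is_curvature_function (K i))).
by case: (hK i).
Qed.

Definition mixed_density u : R :=
  \prod_(i < n) (support_function (K i) u * curvature_function (K i) u) `^ n%:R^-1.

Definition mixed_ratio L u : R :=
  \prod_(i < n) (support_function (L i) u * (support_function (K i) u)^-1).

Let hK_gt0 i u : S u -> 0 < support_function (K i) u.
Proof.
by move=> Su; apply: (comparable_to_one_gt0 (comparable_support_function (K0K i))).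
Qed.

Let fK_ge0 i u : S u -> 0 <= curvature_function (K i) u.
Proof. by case: (curvatureP i) => _ h _; exact: h. Qed.

Lemma mixed_density_ge0 u : S u -> 0 <= mixed_density u.
Proof. by move=> Su; apply: prodr_ge0 => i _; exact: powR_ge0. Qed.

Lemma comparable_mixed_ratio L : (forall i, K0 (L i)) ->
  comparable_to_one S (mixed_ratio L).
Proof.
move=> KL; apply: comparable_to_one_prod => i; apply: comparable_to_oneM.
  exact: comparable_support_function.
by apply: comparable_to_oneV; exact: comparable_support_function.
Qed.

Let measurable_curvature i : measurable_fun S (curvature_function (K i)).
Proof. by case: (curvatureP i) => /(measurable_int _)/measurable_EFinP. Qed.

(** With M_i a bound of h_{K_i} on the sphere, the dominating function is Y = sum_i M_i f_{K_i}:
    each factor of the density is at most Y^(1/n), so their product is at most Y. *)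
Lemma integrable_mixed_density : sigma.-integrable S (EFin \o mixed_density).
Proof.
have hM i : exists M, 0 <= M /\ forall u, S u -> support_function (K i) u <= M.
  have [m [M [m0 mM]]] := support_function_bounds (K0K i).
  exists `|M|; split => // u /mM/andP[_ /le_trans]; apply; exact: ler_norm.
have [M MP] := choice hM.
have yM i u : S u -> 0 <= support_function (K i) u * curvature_function (K i) u
    <= M i * curvature_function (K i) u.
  move=> Su; rewrite mulr_ge0 ?(ltW (hK_gt0 i Su)) ?fK_ge0//=.
  by rewrite ler_wpM2r ?fK_ge0//; apply: (MP i).2.
have : sigma.-integrable S
    (fun u => \sum_(i < n) (M i)%:E * (curvature_function (K i) u)%:E)%E.
  apply: integrable_sum => // i _; apply: integrableZl => //.
  by case: (curvatureP i).
apply: le_integrable => //.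
  apply/measurable_EFinP; apply: measurable_prod => i _.
  apply: (measurableT_comp (measurable_powR n%:R^-1)).
  apply: measurable_funM => //.
  by apply: measurable_funS (measurable_support_function (K0K i)).
move=> u Su /=; under eq_bigr do rewrite -EFinM.
rewrite sumEFin /= lee_fin ger0_norm ?mixed_density_ge0//.
rewrite ger0_norm; last first.
  by apply: sumr_ge0 => i _; have /andP[h1 h2] := yM i u Su; rewrite (le_trans h1).
set Y := \sum_(i < n) _.
have Y0 : 0 <= Y.
  by apply: sumr_ge0 => i _; have /andP[h1 h2] := yM i u Su; rewrite (le_trans h1).
rewrite -[Y](prod_powR_invn n0 Y0).
apply: ler_prod => i _; rewrite powR_ge0 /=.
have /andP[h1 h2] := yM i u Su.
apply: ge0_ler_powR; rewrite ?nnegrE ?invr_ge0//.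
rewrite (le_trans h2)// /Y (bigD1 i)//= lerDl; apply: sumr_ge0 => j _.
by have /andP[h3 h4] := yM j u Su; rewrite (le_trans h3).
Qed.

(** Factor by factor, h_L^p h_K^(1-p) f_K = (h_K f_K) (h_L / h_K)^p. Only the second factor depends
    on p and L. *)
Lemma VpE p L : (forall i, K0 (L i)) ->
  Vp p K L = ((n%:R^-1)%:E * moment sigma S mixed_density (mixed_ratio L) (p / n%:R))%E.
Proof.
move=> KL; rewrite /Vp /moment; congr (_ * _)%E; apply: eq_integral => u /[!inE] Su.
have hL_gt0 i : 0 < support_function (L i) u.
  exact: comparable_to_one_gt0 (comparable_support_function (KL i)) Su.
rewrite /mixed_ratio powR_prod; last first.
  by move=> i; rewrite mulr_ge0 ?invr_ge0 ?(ltW (hL_gt0 _)) ?(ltW (hK_gt0 _ Su)).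
rewrite /mixed_density -big_split /=; congr (_%:E); apply: eq_bigr => i _.
have a0 := hK_gt0 i Su; have f0 := fK_ge0 i Su; have b0 := hL_gt0 i.
rewrite /Lp_curvature_function.
set a := support_function (K i) u in a0 *.
set b := support_function (L i) u in b0 *.
set f := curvature_function (K i) u in f0 *.
rewrite powRrM -powRM ?mulr_ge0 ?powR_ge0 ?(ltW a0)//; congr (_ `^ _).
rewrite powRM ?invr_ge0 ?(ltW a0) ?(ltW b0)// -powR_inv1 ?(ltW a0)// -powRrM mulN1r.
rewrite powRD; last by apply/implyP => _; rewrite gt_eqF.
by rewrite powRr1 ?(ltW a0)//; ring.
Qed.

Let I_phi := (\int[sigma]_(u in S) (mixed_density u)%:E)%E.
Let phi0 := mixed_density_ge0.
Let iphi := integrable_mixed_density.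

Let nR0 : 0 < n%:R :> R. Proof. by rewrite ltr0n. Qed.

Let convex_family L := forall i, K0 (L i).

Lemma Vp_eq0 p L : I_phi = 0%E -> convex_family L -> Vp p K L = 0%E.
Proof.
move=> I0 KL; rewrite VpE// (moment_eq0 mS phi0 iphi)//; first by rewrite mule0.
exact: comparable_mixed_ratio.
Qed.

Lemma fineK_Vp p L : convex_family L -> (fine (Vp p K L))%:E = Vp p K L.
Proof.
move=> KL; rewrite VpE// fineM//.
  rewrite EFinM (fineK_moment mS phi0 iphi)//.
  exact: comparable_mixed_ratio.
by rewrite -(fineK_moment mS phi0 iphi)//; exact: comparable_mixed_ratio.
Qed.

Lemma fine_Vp_gt0 p L : (0 < I_phi)%E -> convex_family L -> 0 < fine (Vp p K L).
Proof.
move=> I0 KL; rewrite -lte_fin fineK_Vp// VpE// mule_gt0 ?lte_fin ?invr_gt0//.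
by apply: (moment_gt0 mS phi0 iphi) => //; exact: comparable_mixed_ratio.
Qed.

Lemma fine_Vp_log_convex r s t l m L : (0 < I_phi)%E -> convex_family L ->
  0 < l -> 0 < m -> l + m = 1 -> r = l * s + m * t ->
  fine (Vp r K L) <= fine (Vp s K L) `^ l * fine (Vp t K L) `^ m.
Proof.
move=> I0 KL l0 m0 lm rE.
have cq := comparable_mixed_ratio KL.
have fE p : fine (Vp p K L) =
    n%:R^-1 * fine (moment sigma S mixed_density (mixed_ratio L) (p / n%:R)).
  by rewrite VpE// fineM// -(fineK_moment mS phi0 iphi).
apply: (powR_scale_log_convex (fE r) (fE s) (fE t)) => //.
- by apply: fine_ge0; exact: moment_ge0.
- by apply: fine_ge0; exact: moment_ge0.
apply: (moment_log_convex mS phi0 iphi cq) => //.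
by rewrite rE mulrDl !mulrA.
Qed.

(** Its sublevel sets are the exceptional sets in the lower bounds below, and its inverse is the
    integrand of the dual mixed volume. *)
Let support_product L u := \prod_(i < n) support_function (L i) u.

Let comparable_support_product L : convex_family L ->
  comparable_to_one S (support_product L).
Proof.
by move=> KL; apply: comparable_to_one_prod => i; exact: comparable_support_function.
Qed.

Let measurable_support_sublevel L d : convex_family L ->
  measurable (S `&` [set u | (support_product L u < d)%R]).
Proof.
move=> /comparable_support_product[mH _].
rewrite (_ : _ `&` _ = S `&` support_product L @^-1` `]-oo, d[); first exact: mH.
by apply/seteqP; split => u; rewrite /= in_itv.
Qed.

(** Here a is the measure of a set A where the density is at least some e > 0. If the exceptional
    set has measure at most a / 2, then at least a / 2 of A remains, and there the ratio is at least
    d / Q', with Q' bounding the product of the h_{K_i}. The constant c does not depend on L or d,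
    so d may be adapted to L. *)
Let fine_Vp_lower_bound : (0 < I_phi)%E -> exists2 a, 0 < a &
  forall s, 0 <= s -> exists2 c, 0 < c & forall L d, convex_family L -> 0 < d ->
  (sigma (S `&` [set u | (support_product L u < d)%R]) <= (a / 2)%:E)%E ->
  c * d `^ (s / n%:R) <= fine (Vp s K L).
Proof.
move=> I0; have [e e0 [mA A0]] := moment_gt0_superlevel mS phi0 iphi I0.
set A := S `&` _ in mA A0.
have sA : (fine (sigma A))%:E = sigma A.
  by rewrite fineK// ge0_fin_numE// spherical_measure_lty.
set a := fine _ in sA; have a0 : 0 < a by rewrite -lte_fin sA.
exists a => // s s0.
have [_ [m [Q [m0 hQ]]]] := comparable_support_product K0K.
pose Q' := `|Q| + 1; have Q0 : 0 < Q' by rewrite ltr_wpDl.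
have QK u : S u -> support_product K u <= Q'.
  move=> /hQ/andP[_ h]; rewrite (le_trans h)// (le_trans (ler_norm _))//.
  by rewrite lerDl.
exists (n%:R^-1 * (e * Q'^-1 `^ (s / n%:R)) * (a / 2)).
  by rewrite !mulr_gt0 ?invr_gt0 ?powR_gt0 ?invr_gt0.
move=> L d KL d0 bad; rewrite -lee_fin fineK_Vp// VpE//.
set B := S `&` _ in bad; have mB : measurable B by exact: measurable_support_sublevel.
have cq := comparable_mixed_ratio KL.
have AB : ((a / 2)%:E <= sigma (A `\` B))%E.
  have : (a%:E <= sigma (A `\` B) + sigma B)%E.
    rewrite sA -measureU//; last 2 first.
    - exact: measurableD.
    - by apply/seteqP; split => // u [[]].
    apply: le_measure; rewrite ?inE//; first by apply: measurableU => //; exact: measurableD.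
    by move=> u Au; have [Bu|Bu] := pselect (B u); [right|left].
  have -> : sigma (A `\` B) = (fine (sigma (A `\` B)))%:E.
    by rewrite fineK// ge0_fin_numE// spherical_measure_lty//; exact: measurableD.
  move=> /le_trans/(_ (leeD2l _ bad)); rewrite -EFinD !lee_fin; lra.
have -> : n%:R^-1 * (e * Q'^-1 `^ (s / n%:R)) * (a / 2) * d `^ (s / n%:R) =
    n%:R^-1 * (e * (Q'^-1 * d) `^ (s / n%:R) * (a / 2)).
  by rewrite powRM ?invr_ge0 ?(ltW Q0) ?(ltW d0)//; ring.
rewrite EFinM lee_wpmul2l ?lee_fin ?invr_ge0//.
have eta0 : 0 <= Q'^-1 * d by rewrite mulr_ge0 ?invr_ge0 ?(ltW Q0) ?(ltW d0).
apply: (le_trans _ (moment_lower_bound mS phi0 iphi cq (divr_ge0 s0 (ltW nR0))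
  (ltW e0) eta0 (measurableD mA mB) _)).
  by rewrite EFinM lee_wpmul2l// lee_fin mulr_ge0 ?powR_ge0 ?(ltW e0).
move=> u [[Su eu] nB]; split => //.
have hq : mixed_ratio L u * support_product K u = support_product L u.
  rewrite /mixed_ratio -big_split /=; apply: eq_bigr => i _.
  by rewrite divfK// gt_eqF// hK_gt0.
have K_gt0 : 0 < support_product K u.
  exact: (comparable_to_one_gt0 (comparable_support_product K0K)).
have dL : d <= support_product L u by rewrite leNgt; apply/negP => h; apply: nB.
rewrite mulrC ler_pdivrMr// (le_trans dL)// -hq ler_wpM2l ?QK//.
exact: (ltW (comparable_to_one_gt0 cq Su)).
Qed.

Let volume_polarK (L : set 'rV[R]_n) : K0 L ->
  (fine (volume (polar L)))%:E = volume (polar L).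
Proof. by move=> KL; rewrite fineK// ge0_fin_numE// volume_polar_lty. Qed.

Let volume_polar_gt (L : set 'rV[R]_n) : K0 L -> 0 < fine (volume (polar L)).
Proof. by move=> KL; rewrite fine_gt0// volume_polar_gt0// volume_polar_lty. Qed.

(** With W the geometric mean of the polar volumes, the threshold d is taken as b / W, so that c
    d^(s/n) W^(s/n) no longer depends on L. *)
Lemma Vp_volume_lower_bound s : (0 < I_phi)%E -> 0 <= s -> exists2 c, 0 < c &
  forall L, convex_family L ->
  c <= fine (Vp s K L) *
    (\prod_(i < n) fine (volume (polar (L i))) `^ n%:R^-1) `^ (s / n%:R).
Proof.
move=> I0 s0; have [a a0 /(_ s s0)[c c0 LB]] := fine_Vp_lower_bound I0.
(* The exceptional set will be covered by n sets of measure at most n b each, and n^2 b = a / 2. *)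
pose b := a / (2 * n%:R ^+ 2); have b0 : 0 < b by rewrite divr_gt0// mulr_gt0// exprn_gt0.
exists (c * b `^ (s / n%:R)); first by rewrite mulr_gt0// powR_gt0.
move=> L KL; pose w i := fine (volume (polar (L i))).
have w0 i : 0 < w i by exact: volume_polar_gt.
pose W := \prod_(i < n) w i `^ n%:R^-1.
have W0 : 0 < W by apply: prodr_gt0 => i _; exact: powR_gt0.
(* This makes the cone bound n d_i^n w_i equal to n b for every i, while the product of the d_i is b
   / W. *)
pose d i := (b / w i) `^ n%:R^-1.
have d0 i : 0 < d i by rewrite powR_gt0// divr_gt0.
have dE : \prod_(i < n) d i = b * W^-1.
  rewrite -[b](prod_powR_invn n0 (ltW b0)).
  rewrite /W -prodfV -big_split /=; apply: eq_bigr => i _.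
  rewrite /d powRM ?invr_ge0 ?(ltW b0) ?(ltW (w0 i))//.
  by rewrite -[(w i)^-1]powR_inv1 ?(ltW (w0 i))// powRAC powR_inv1 ?powR_ge0.
have dn i : d i ^+ n = b / w i.
  rewrite /d -powR_mulrn ?powR_ge0// -powRrM mulVf ?gt_eqF// powRr1//.
  by rewrite divr_ge0 ?ltW.
have dd0 : 0 < \prod_(i < n) d i by apply: prodr_gt0 => i _.
have := LB L (\prod_(i < n) d i) KL dd0.
rewrite dE => h.
rewrite -ler_pdivrMr ?powR_gt0// -/W.
apply: le_trans (h _).
  rewrite (@powRM _ b W^-1) ?invr_ge0 ?(ltW b0) ?(ltW W0)// mulrA.
  by rewrite -[W^-1]powR_inv1 ?(ltW W0)// powRAC powR_inv1 ?powR_ge0.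
rewrite -dE.
(* Where the product of the h_{L_i} is below the product of the d_i, some h_{L_i} is at most d_i;
   thus the B i cover the exceptional set. *)
pose B i := S `&` [set u | (support_function (L i) u <= d i)%R].
have mB i : measurable (B i).
  apply: measurableI => //.
  rewrite (_ : [set _ | _] = support_function (L i) @^-1` `]-oo, d i]).
    by apply: measurable_preimageT => //; exact: measurable_support_function.
  by apply/seteqP; split => u; rewrite /= in_itv.
apply: (@le_trans _ _ (sigma (\big[setU/set0]_(i < n) B i))).
  apply: le_measure; rewrite ?inE; first exact: measurable_support_sublevel.
    exact: bigsetU_measurable.
  move=> u [Su /= uH]; rewrite -bigcup_seq /=.
  have [[i iB]|nB] := pselect (exists i, B i u).
    by exists i; rewrite /= ?mem_index_enum//; exact: iB.
  suff : \prod_(i < n) d i <= support_product L u by rewrite leNgt uH.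
  apply: ler_prod => i _; rewrite ltW//= leNgt; apply/negP => h'.
  by apply: nB; exists i; split => //=; exact: ltW.
apply: (@le_trans _ _ (\sum_(i < n) (n%:R * b)%:E)%E).
  apply: (@le_trans _ _ (\sum_(i < n) sigma (B i))%E).
    exact: measure_bigsetU_le.
  apply: lee_sum => i _.
  apply: le_trans (spherical_measure_support_le (KL i) (d0 i)) _.
  rewrite dn -volume_polarK// -EFinM lee_fin -/(w i) mulrA divfK ?gt_eqF//.
rewrite sumEFin lee_fin sumr_const card_ord /b -mulr_natl.
by rewrite le_eqVlt; apply/orP; left; apply/eqP; field; rewrite gt_eqF.
Qed.

Let one0 u : S u -> (0 : R) <= 1. Proof. by []. Qed.

Let integrable_one : sigma.-integrable S (EFin \o (fun=> 1 : R)).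
Proof.
apply/integrableP; split; first exact/measurable_EFinP/measurable_cst.
rewrite (eq_integral (cst 1%:E)); last by move=> u _; rewrite /= normr1.
by rewrite integral_cst// mul1e spherical_measure_lty.
Qed.

Let sphere_gt0 : (0 < \int[sigma]_(u in S) (1 : R)%:E)%E.
Proof. by rewrite integral_cst// mul1e spherical_measure_sphere_gt0. Qed.

Let comparable_inv_support_product L : convex_family L ->
  comparable_to_one S (fun u => (support_product L u)^-1).
Proof. by move=> KL; apply: comparable_to_oneV; exact: comparable_support_product. Qed.

(** Since the radial function of the polar is 1 / h_L, this is a moment with constant density 1, and
    the general facts on moments apply. *)
Let dual_mixed_volumeE L : convex_family L ->
  dual_mixed_volume (fun i => polar (L i)) = ((n%:R^-1)%:E *
    moment sigma S (fun=> 1%R) (fun u => (support_product L u)^-1)%R 1%R)%E.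
Proof.
move=> KL; rewrite /dual_mixed_volume /moment; congr (_ * _)%E.
apply: eq_integral => u /[!inE] Su.
have cH := comparable_inv_support_product KL.
rewrite mul1r powRr1 ?(ltW (comparable_to_one_gt0 cH Su))// -prodfV.
by congr (_%:E); apply: eq_bigr => i _; rewrite radial_function_polar.
Qed.

Lemma fineK_dual_mixed_volume L : convex_family L ->
  (fine (dual_mixed_volume (fun i => polar (L i))))%:E =
  dual_mixed_volume (fun i => polar (L i)).
Proof.
move=> KL; have cH := comparable_inv_support_product KL.
rewrite dual_mixed_volumeE// fineM//.
  by rewrite EFinM (fineK_moment mS one0 integrable_one).
by rewrite -(fineK_moment mS one0 integrable_one).
Qed.

Lemma fine_dual_mixed_volume_gt0 L : convex_family L ->
  0 < fine (dual_mixed_volume (fun i => polar (L i))).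
Proof.
move=> KL; have cH := comparable_inv_support_product KL.
rewrite -lte_fin fineK_dual_mixed_volume// dual_mixed_volumeE//.
rewrite mule_gt0 ?lte_fin ?invr_gt0//.
exact: (moment_gt0 mS one0 integrable_one).
Qed.

(** With W the dual mixed volume and threshold b / W, Chebyshev's inequality for the inverse of the
    support product bounds the exceptional set by n W (b / W) = n b, which is a / 2 for b = a / (2
    n). *)
Lemma Vp_dual_mixed_volume_lower_bound s : (0 < I_phi)%E -> 0 <= s ->
  exists2 c, 0 < c & forall L, convex_family L ->
  c <= fine (Vp s K L) *
    fine (dual_mixed_volume (fun i => polar (L i))) `^ (s / n%:R).
Proof.
move=> I0 s0; have [a a0 /(_ s s0)[c c0 LB]] := fine_Vp_lower_bound I0.
pose b := a / (2 * n%:R); have b0 : 0 < b by rewrite divr_gt0// mulr_gt0.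
exists (c * b `^ (s / n%:R)); first by rewrite mulr_gt0// powR_gt0.
move=> L KL; have := fine_dual_mixed_volume_gt0 KL.
have := fineK_dual_mixed_volume KL; rewrite (dual_mixed_volumeE KL).
set W := fine _ => WE W0.
rewrite -ler_pdivrMr ?powR_gt0//.
have d0 : 0 < b / W by rewrite divr_gt0.
apply: le_trans (LB L (b / W) KL d0 _).
  rewrite (@powRM _ b W^-1) ?invr_ge0 ?(ltW b0) ?(ltW W0)// mulrA.
  by rewrite -[W^-1]powR_inv1 ?(ltW W0)// powRAC powR_inv1 ?powR_ge0.
set B := S `&` _; have mB : measurable B by exact: measurable_support_sublevel.
have cH := comparable_inv_support_product KL.
have hB u : B u -> [/\ S u, (1 : R) <= 1 & (b / W)^-1 <= (support_product L u)^-1].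
  move=> [Su /= h]; split => //.
  rewrite lef_pV2 ?posrE//; first exact: ltW.
  exact: (comparable_to_one_gt0 (comparable_support_product KL)).
have d1 : 0 <= (b / W)^-1 by rewrite invr_ge0 ltW.
have := moment_lower_bound mS one0 integrable_one cH ler01 ler01 d1 mB hB.
rewrite mul1r powRr1// => h.
have sB : (fine (sigma B))%:E = sigma B.
  by rewrite fineK// ge0_fin_numE// spherical_measure_lty.
have : ((n%:R^-1 * (b / W)^-1)%:E * sigma B <= W%:E)%E.
  by rewrite WE EFinM -muleA lee_wpmul2l// lee_fin invr_ge0.
rewrite -sB -EFinM !lee_fin -ler_pdivlMl; last by rewrite mulr_gt0 ?invr_gt0.
move=> /le_trans; apply; rewrite le_eqVlt; apply/orP; left; apply/eqP.
by rewrite /b; field; rewrite !gt_eqF.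
Qed.

End mixed_volumes.

(** * Extended powers and interpolation *)

Section extended_powers.
Context {R : realType}.
Implicit Types (x y : \bar R) (a b c : R).
Local Open Scope ereal_scope.

Lemma epower_ge0 x a : 0 <= epower x a.
Proof. by rewrite /epower; case: ifP => _; rewrite ?inve_ge0 poweR_ge0. Qed.

Lemma epower_EFin (r a : R) : (0 < r)%R -> epower r%:E a = (r `^ a)%:E.
Proof.
move=> r0; rewrite /epower; case: ifP => // _; rewrite poweR_EFin inver gt_eqF ?powR_gt0//.
by rewrite -powRN opprK.
Qed.

Lemma epowery_neg a : (a < 0)%R -> epower +oo a = 0.
Proof.
by move=> a0; rewrite /epower (lt_geF a0) poweRyr ?invey// oppr_eq0 lt_eqF.
Qed.

Lemma epower0_neg a : (a < 0)%R -> epower 0 a = +oo.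
Proof. by move=> a0; rewrite /epower (lt_geF a0) poweR0r ?inve0// oppr_eq0 lt_eqF. Qed.

Lemma epower0_pos a : (0 < a)%R -> epower 0 a = 0.
Proof. by move=> a0; rewrite /epower (ltW a0) poweR0r// gt_eqF. Qed.

Lemma le_epower x y a : (0 < a)%R -> 0 <= x -> x <= y -> epower x a <= epower y a.
Proof.
move=> a0 x0 xy; rewrite /epower (ltW a0) gt0_ler_poweR ?(ltW a0)// ?in_itv/= ?leey ?andbT//.
exact: le_trans xy.
Qed.

Lemma ler_powR_inv (u z b : R) : (0 < b)%R -> (0 <= u)%R -> (0 <= z)%R ->
  (u <= z `^ b^-1)%R = (u `^ b <= z)%R.
Proof.
move=> b0 u0 z0; apply/idP/idP => h.
  rewrite -[leRHS](powRr1 z0) -(mulVf (lt0r_neq0 b0)) powRrM.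
  by rewrite ge0_ler_powR ?nnegrE ?powR_ge0// ltW.
rewrite -[leLHS](powRr1 u0) -(divff (lt0r_neq0 b0)) powRrM.
by rewrite ge0_ler_powR ?nnegrE ?powR_ge0 ?invr_ge0// ltW.
Qed.

(** For x and y real and positive, (x / y)^(1/a) is a lower bound of F. Positivity of the infimum is
    what keeps the right-hand side from being 0 * oo when y = +oo. *)
Lemma le_epower_inf (I : Type) (S : set I) (F : I -> R) x y a L0 : S L0 ->
  (0 < a)%R -> (forall L, S L -> (0 < F L)%R) -> 0 < y ->
  0 < ereal_inf [set (F L)%:E | L in S] ->
  (forall L, S L -> x <= (F L `^ a)%:E * y) ->
  x <= epower (ereal_inf [set (F L)%:E | L in S]) a * y.
Proof.
move=> SL0 a0 F0 y0; set g := ereal_inf _ => g0 h.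
have gF L : S L -> g <= (F L)%:E by move=> SL; apply: ereal_inf_lbound; exists L.
have gfin : g \is a fin_num by rewrite ge0_fin_numE ?ltW// (le_lt_trans (gF _ SL0))// ltry.
have [r gE] : exists r, g = r%:E by exists (fine g); rewrite fineK.
have r0 : (0 < r)%R by rewrite -lte_fin -gE.
rewrite gE epower_EFin//.
case: y y0 h => [y y0 h|_ _|//]; last first.
  by rewrite gt0_muley ?leey// lte_fin powR_gt0.
case: x h => [x h|h|_]; last by rewrite leNye.
  rewrite -EFinM lee_fin; have [x0|x0] := leP x 0%R.
    by rewrite (le_trans x0)// mulr_ge0 ?powR_ge0// ltW.
  rewrite lte_fin in y0; rewrite -ler_pdivrMr// -[a in leRHS]invrK.
  have xy0 : (0 <= x / y)%R by rewrite divr_ge0// ltW.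
  rewrite ler_powR_inv ?invr_gt0// ?(ltW r0)//.
  rewrite -lee_fin -gE; apply: le_ereal_inf_tmp => _ [L SL <-].
  rewrite lee_fin -ler_powR_inv ?invr_gt0 ?(ltW (F0 _ SL))// invrK.
  by rewrite ler_pdivrMr// -lee_fin EFinM; exact: h.
by have := h _ SL0; rewrite leye_eq -EFinM.
Qed.

(** For finite x, (x / c)^(1/b) is an upper bound of F, so the supremum is finite and the comparison
    takes place among reals. *)
Lemma ge_epower_sup (I : Type) (S : set I) (F : I -> R) x b c L0 : S L0 ->
  (0 < b)%R -> (0 < c)%R -> (forall L, S L -> (0 < F L)%R) ->
  (forall L, S L -> (c * F L `^ b)%:E <= x) ->
  c%:E * epower (ereal_sup [set (F L)%:E | L in S]) b <= x.
Proof.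
move=> SL0 b0 c0 F0; set g := ereal_sup _ => h.
have Fg L : S L -> (F L)%:E <= g by move=> SL; apply: ereal_sup_ubound; exists L.
have cF0 : (0 < c * F L0 `^ b)%R by rewrite mulr_gt0 ?powR_gt0// F0.
case: x h => [x h|_|h]; [|by rewrite leey|by have := h _ SL0].
have x0 : (0 < x)%R by rewrite -lte_fin (lt_le_trans _ (h _ SL0))// lte_fin.
have xc0 : (0 <= x / c)%R by rewrite divr_ge0// ltW.
have gx : g <= ((x / c) `^ b^-1)%:E.
  apply: ge_ereal_sup => _ [L SL <-].
  rewrite lee_fin ler_powR_inv ?(ltW (F0 _ SL))// ler_pdivlMr// mulrC -lee_fin.
  exact: h.
have g0 : 0 < g by rewrite (lt_le_trans _ (Fg _ SL0))// lte_fin F0.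
have gfin : g \is a fin_num by rewrite ge0_fin_numE ?ltW// (le_lt_trans gx)// ltry.
have [r gE] : exists r, g = r%:E by exists (fine g); rewrite fineK.
have r0 : (0 < r)%R by rewrite -lte_fin -gE.
rewrite gE epower_EFin// -EFinM lee_fin mulrC -ler_pdivlMr//.
by rewrite -ler_powR_inv ?(ltW r0)// -lee_fin -gE.
Qed.

End extended_powers.

(** * Exact interpolation of the functional at a fixed family *)

Section interpolation.
Context {R : realType}.

(** N is the dimension, v the mixed volume [Vp], and w the polar volume, the geometric mean of the
    polar volumes, or the dual mixed volume. *)
Definition functional (N p v w : R) := N * v `^ (N / (N + p)) * w `^ (p / (N + p)).

Lemma functional_gt0 (N p v w : R) : 0 < N -> 0 < v -> 0 < w ->
  0 < functional N p v w.
Proof. by move=> N0 v0 w0; rewrite !mulr_gt0 ?powR_gt0. Qed.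

(** The two exponents a and b satisfy a + b = 1 and a s/(N + s) + b t/(N + t) = r/(N + r), so the
    powers of N and w match; and a/(N + s) is (t - r)/(t - s) divided by N + r, and similarly for
    b. *)
Lemma functional_interpolation (N r s t x y w : R) : 0 < N -> 0 < x -> 0 < y ->
  0 < w -> N + r != 0 -> N + s != 0 -> N + t != 0 -> t != s ->
  functional N s x w `^ (((t - r) * (N + s)) / ((t - s) * (N + r))) *
  functional N t y w `^ (((r - s) * (N + t)) / ((t - s) * (N + r))) =
  functional N r (x `^ ((t - r) / (t - s)) * y `^ ((r - s) / (t - s))) w.
Proof.
move=> N0 x0 y0 w0 Nr Ns Nt ts; have tms : t - s != 0 by rewrite subr_eq0.
set a := (_ / _) : R; set b := (r - s) * _ / _; rewrite /functional.
have ge0 := (powR_ge0, ltW N0, ltW x0, ltW y0, ltW w0).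
rewrite !powRM ?mulr_ge0 ?ge0// -!powRrM.
have -> : N `^ a * x `^ (N / (N + s) * a) * w `^ (s / (N + s) * a) *
   (N `^ b * y `^ (N / (N + t) * b) * w `^ (t / (N + t) * b)) =
   (N `^ a * N `^ b) * (x `^ (N / (N + s) * a) * y `^ (N / (N + t) * b)) *
   (w `^ (s / (N + s) * a) * w `^ (t / (N + t) * b)) by ring.
rewrite -!powRD; try by apply/implyP => _; rewrite gt_eqF.
congr (_ * (_ * _) * _).
- rewrite -[RHS](powRr1 (ltW N0)); congr (_ `^ _).
  by rewrite /a /b; field; rewrite Nr.
- by congr (_ `^ _); rewrite /a; field; rewrite ?Nr ?Ns ?Nt ?tms.
- by congr (_ `^ _); rewrite /b; field; rewrite ?Nr ?Ns ?Nt ?tms.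
- by congr (_ `^ _); rewrite /a /b; field; rewrite ?Nr ?Ns ?Nt ?tms.
Qed.

End interpolation.

Section interpolates.
Context {R : realType} (N : R).
Implicit Types (r s t : R) (G : R -> \bar R).
Local Open Scope ereal_scope.

Definition exponent1 r s t : R := (((t - r) * (N + s)) / ((t - s) * (N + r)))%R.
Definition exponent2 r s t : R := (((r - s) * (N + t)) / ((t - s) * (N + r)))%R.

Lemma exponent1_swap r s t : exponent1 r t s = exponent2 r s t.
Proof.
by rewrite /exponent1 /exponent2 -(opprB r s) -(opprB t s) !mulNr invrN mulrN opprK.
Qed.

Lemma exponent2_swap r s t : exponent2 r t s = exponent1 r s t.
Proof. by rewrite -exponent1_swap. Qed.

Definition interpolates G := forall r s t,
  [/\ [&& - N < t, t < 0, 0 < r & r < s]%R \/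
      [&& - N < s, s < 0, 0 < r & r < t]%R ->
        G r <= epower (G s) (exponent1 r s t) * epower (G t) (exponent2 r s t),
      [&& - N < t, t < r, r < s & s < 0]%R \/
      [&& - N < s, s < r, r < t & t < 0]%R ->
        G r <= epower (G s) (exponent1 r s t) * epower (G t) (exponent2 r s t)
    & [&& t < r, r < - N, - N < s & s < 0]%R \/
      [&& s < r, r < - N, - N < t & t < 0]%R ->
        G r >= epower (G s) (exponent1 r s t) * epower (G t) (exponent2 r s t)].

(** Exchanging s and t exchanges the two exponents, so one ordering suffices in each claim. *)
Lemma interpolatesP G :
  (forall r s t, (- N < t < 0)%R -> (0 < r < s)%R ->
    G r <= epower (G s) (exponent1 r s t) * epower (G t) (exponent2 r s t)) ->
  (forall r s t, (- N < t < r)%R -> (r < s < 0)%R ->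
    G r <= epower (G s) (exponent1 r s t) * epower (G t) (exponent2 r s t)) ->
  (forall r s t, (t < r < - N)%R -> (- N < s < 0)%R ->
    G r >= epower (G s) (exponent1 r s t) * epower (G t) (exponent2 r s t)) ->
  interpolates G.
Proof.
move=> h1 h2 h3 r s t; split => -[] /and4P[k1 k2 k3 k4].
- by apply: h1; rewrite ?k1 ?k3.
- by rewrite muleC -(exponent1_swap r s) -(exponent2_swap r s); apply: h1; rewrite ?k1 ?k3.
- by apply: h2; rewrite ?k1 ?k3.
- by rewrite muleC -(exponent1_swap r s) -(exponent2_swap r s); apply: h2; rewrite ?k1 ?k3.
- by apply: h3; rewrite ?k1 ?k3.
- by rewrite muleC -(exponent1_swap r s) -(exponent2_swap r s); apply: h3; rewrite ?k1 ?k3.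
Qed.

Lemma degenerate_interpolates G : (0 < N)%R ->
  (forall r, r != 0%R -> (- N < r)%R -> G r = 0) ->
  (forall r, (r < - N)%R -> G r = +oo) -> interpolates G.
Proof.
move=> N0 G0 Gy; apply: interpolatesP => r s t /andP[h1 h2] /andP[h3 h4].
- by rewrite G0 ?mule_ge0 ?epower_ge0 ?gt_eqF//; lra.
- by rewrite G0 ?mule_ge0 ?epower_ge0 ?lt_eqF//; lra.
- by rewrite [G r]Gy ?leey.
Qed.

End interpolates.

(** * Passage from a fixed family to infima and suprema *)

Section optimum_interpolation.
Context {R : realType} (I : Type) (S : set I) (L0 : I) (N : R).
Hypotheses (SL0 : S L0) (N0 : 0 < N).
Implicit Types r s t p : R.
Local Open Scope ereal_scope.

Local Notation exponent1 := (exponent1 N).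
Local Notation exponent2 := (exponent2 N).

Section positive.
Variables (v : R -> I -> R) (w : I -> R).
Hypothesis v0 : forall p L, S L -> (0 < v p L)%R.
Hypothesis w0 : forall L, S L -> (0 < w L)%R.
Hypothesis v_log_convex : forall r s t l m L, S L -> (0 < l)%R -> (0 < m)%R ->
  (l + m = 1)%R -> (r = l * s + m * t)%R ->
  (v r L <= v s L `^ l * v t L `^ m)%R.
Hypothesis vw_lower : forall s, (0 <= s)%R -> exists2 c, (0 < c)%R &
  forall L, S L -> (c <= v s L * w L `^ (s / N))%R.

Let F p L := functional N p (v p L) (w L).
Let G p := optimum p [set (F p L)%:E | L in S].

Let F0 p L : S L -> (0 < F p L)%R.
Proof. by move=> SL; apply: functional_gt0 => //; [exact: v0|exact: w0]. Qed.

Let weights r s t : (t < r < s)%R || (s < r < t)%R ->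
  [/\ 0 < (t - r) / (t - s), 0 < (r - s) / (t - s),
    (t - r) / (t - s) + (r - s) / (t - s) = 1 &
    r = (t - r) / (t - s) * s + (r - s) / (t - s) * t]%R.
Proof.
move=> rst; have ts : (t - s != 0)%R.
  by rewrite subr_eq0; case/orP: rst => /andP[/lt_trans h /h]; [move/lt_eqF|move/gt_eqF] => ->.
split; [| |by field|by field].
  case/orP: rst => /andP[h1 h2].
    by rewrite -mulrNN -invrN divr_gt0// opprB subr_gt0// (lt_trans h1).
  by rewrite divr_gt0// subr_gt0// (lt_trans h1).
case/orP: rst => /andP[h1 h2].
  by rewrite -mulrNN -invrN divr_gt0// opprB subr_gt0// (lt_trans h1).
by rewrite divr_gt0// subr_gt0// (lt_trans h1).
Qed.

Let F_le r s t L : S L -> (t < r < s)%R || (s < r < t)%R ->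
  (- N < r)%R -> (N + s != 0)%R -> (N + t != 0)%R ->
  (F r L <= F s L `^ exponent1 r s t * F t L `^ exponent2 r s t)%R.
Proof.
move=> SL rst Nr Ns Nt; have [l0 m0 lm rE] := weights rst.
have ts : (t != s)%R.
  by case/orP: rst => /andP[/lt_trans h /h]; [move/lt_eqF|move/gt_eqF] => ->.
have Nr0 : (0 < N + r)%R by rewrite addrC -ltrBlDr sub0r.
rewrite /F (functional_interpolation N0 (v0 s SL) (v0 t SL) (w0 SL) (lt0r_neq0 Nr0) Ns Nt ts).
rewrite /functional ler_wpM2r ?powR_ge0// ler_wpM2l ?(ltW N0)//.
apply: ge0_ler_powR; rewrite ?nnegrE.
- exact: divr_ge0 (ltW N0) (ltW Nr0).
- exact: ltW (v0 _ SL).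
- by rewrite mulr_ge0 ?powR_ge0.
exact: v_log_convex.
Qed.

Let F_ge r s t L : S L -> (t < r < s)%R || (s < r < t)%R ->
  (r < - N)%R -> (N + s != 0)%R -> (N + t != 0)%R ->
  (F s L `^ exponent1 r s t * F t L `^ exponent2 r s t <= F r L)%R.
Proof.
move=> SL rst Nr Ns Nt; have [l0 m0 lm rE] := weights rst.
have ts : (t != s)%R.
  by case/orP: rst => /andP[/lt_trans h /h]; [move/lt_eqF|move/gt_eqF] => ->.
have Nr0 : (N + r < 0)%R by rewrite addrC -ltrBrDr sub0r.
rewrite /F (functional_interpolation N0 (v0 s SL) (v0 t SL) (w0 SL) (ltr0_neq0 Nr0) Ns Nt ts).
rewrite /functional ler_wpM2r ?powR_ge0// ler_wpM2l ?(ltW N0)//.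
have -> : (N / (N + r) = - (N / - (N + r)))%R by rewrite invrN mulrN opprK.
rewrite !(powRN _ (N / _)) lef_pV2 ?posrE ?powR_gt0 ?mulr_gt0 ?powR_gt0 ?v0//.
apply: ge0_ler_powR; rewrite ?nnegrE.
- by rewrite divr_ge0 ?(ltW N0)// oppr_ge0 ltW.
- exact: ltW (v0 _ SL).
- by rewrite mulr_ge0 ?powR_ge0.
exact: v_log_convex.
Qed.

Let inf_gt0 s : (0 < s)%R -> 0 < ereal_inf [set (F s L)%:E | L in S].
Proof.
move=> s0; have [c c0 hc] := vw_lower (ltW s0).
have Ns0 : (0 < N + s)%R by rewrite addr_gt0.
apply: (@lt_le_trans _ _ (N * c `^ (N / (N + s)))%:E).
  by rewrite lte_fin mulr_gt0// powR_gt0.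
apply: le_ereal_inf_tmp => _ [L SL <-]; rewrite lee_fin /F /functional -mulrA.
rewrite ler_wpM2l ?(ltW N0)//.
(* The functional equals N (v w^(s/N))^(N/(N+s)), which explains the form of [vw_lower]. *)
have -> : (s / (N + s) = s / N * (N / (N + s)))%R by field; rewrite ?gt_eqF.
rewrite [X in (_ <= _ * X)%R]powRrM -powRM ?powR_ge0 ?(ltW (v0 _ SL))//.
apply: ge0_ler_powR; rewrite ?nnegrE.
- exact: divr_ge0 (ltW N0) (ltW Ns0).
- exact: ltW.
- by rewrite mulr_ge0 ?powR_ge0// ltW// v0.
exact: hc.
Qed.

Let exp_gt0 r s t : (t < r < s)%R -> (- N < t)%R ->
  (0 < exponent1 r s t)%R /\ (0 < exponent2 r s t)%R.
Proof.
move=> /andP[tr rs] Nt; rewrite /exponent1 /exponent2.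
have ts : (t - s < 0)%R by rewrite subr_lt0 (lt_trans tr).
have [Nt0 Nr0 Ns0] : [/\ 0 < N + t, 0 < N + r & 0 < N + s]%R by split; lra.
have tr0 : (t - r < 0)%R by rewrite subr_lt0.
have rs0 : (r - s < 0)%R by rewrite subr_lt0.
by split; rewrite -mulrNN -invrN divr_gt0// -mulNr mulr_gt0// oppr_gt0.
Qed.

Let G_sup p : (p < 0)%R -> G p = ereal_sup [set (F p L)%:E | L in S].
Proof. by move=> p0; rewrite /G /optimum (lt_gtF p0). Qed.

Let G_inf p : (0 < p)%R -> G p = ereal_inf [set (F p L)%:E | L in S].
Proof. by move=> p0; rewrite /G /optimum p0. Qed.

Let F_le_G p L : (p < 0)%R -> S L -> (F p L)%:E <= G p.
Proof. by move=> p0 SL; rewrite G_sup//; apply: ereal_sup_ubound; exists L. Qed.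

(** At fixed L, G r <= F r L and F t L <= G t, while F s L is kept; the infimum over L is then taken
    in that factor alone. *)
Let interpolation_inf r s t : (- N < t < 0)%R -> (0 < r < s)%R ->
  G r <= epower (G s) (exponent1 r s t) * epower (G t) (exponent2 r s t).
Proof.
move=> /andP[Nt t0] /andP[r0 rs]; have s0 := lt_trans r0 rs.
have tr := lt_trans t0 r0.
have [a0 b0] := @exp_gt0 r s t ltac:(by rewrite tr rs) Nt.
have Gt0 : 0 < G t.
  by apply: lt_le_trans (F_le_G t0 SL0); rewrite lte_fin F0.
have y0 : 0 < epower (G t) (exponent2 r s t).
  by rewrite /epower (ltW b0) poweR_gt0.
rewrite (G_inf s0).
apply: le_epower_inf => //; [exact: SL0|by move=> L; exact: F0|exact: inf_gt0|].
move=> L SL; apply: (@le_trans _ _ (F r L)%:E).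
  by rewrite G_inf//; apply: ereal_inf_lbound; exists L.
apply: (@le_trans _ _ (F s L `^ exponent1 r s t * F t L `^ exponent2 r s t)%:E).
  rewrite lee_fin; apply: F_le => //; [by rewrite tr rs|lra|lra|lra].
rewrite EFinM lee_wpmul2l ?lee_fin ?powR_ge0// -epower_EFin ?F0//.
apply: le_epower => //; first by rewrite lee_fin ltW// F0.
exact: F_le_G.
Qed.

Let interpolation_sup r s t : (- N < t < r)%R -> (r < s < 0)%R ->
  G r <= epower (G s) (exponent1 r s t) * epower (G t) (exponent2 r s t).
Proof.
move=> /andP[Nt tr] /andP[rs s0].
have [a0 b0] := @exp_gt0 r s t ltac:(by rewrite tr rs) Nt.
have r0 := lt_trans rs s0; have t0 := lt_trans tr r0.
rewrite (G_sup r0); apply: ge_ereal_sup => _ [L SL <-].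
apply: (@le_trans _ _ (epower (F s L)%:E (exponent1 r s t) * epower (F t L)%:E (exponent2 r s t))).
  rewrite !epower_EFin ?F0// -EFinM lee_fin.
  by apply: F_le => //; [rewrite tr rs|lra|lra|lra].
apply: lee_pmul; rewrite ?epower_ge0//; apply: le_epower => //.
- by rewrite lee_fin ltW// F0.
- exact: F_le_G.
- by rewrite lee_fin ltW// F0.
- exact: F_le_G.
Qed.

(** The first exponent is negative and the second positive: F s L <= G s lowers the first factor,
    and the supremum over L is then taken in F t L. *)
Let interpolation_below r s t : (t < r < - N)%R -> (- N < s < 0)%R ->
  G r >= epower (G s) (exponent1 r s t) * epower (G t) (exponent2 r s t).
Proof.
move=> /andP[tr rN] /andP[Ns s0].
have r0 : (r < 0)%R by lra.
have t0 : (t < 0)%R by lra.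
have rs : (r < s)%R by lra.
have [ts rs0 tr0] : [/\ t - s < 0, r - s < 0 & t - r < 0]%R by split; lra.
have [Nr0 Ns0 Nt0] : [/\ N + r < 0, 0 < N + s & N + t < 0]%R by split; lra.
have D0 : (0 < (t - s) * (N + r))%R by rewrite nmulr_lgt0.
have a0 : (exponent1 r s t < 0)%R by rewrite pmulr_llt0 ?invr_gt0// nmulr_rlt0.
have b0 : (0 < exponent2 r s t)%R by rewrite divr_gt0// nmulr_lgt0.
have Gr0 : 0 <= G r.
  by apply: le_trans (F_le_G r0 SL0); rewrite lee_fin ltW// F0.
have Gs0 : 0 < G s.
  by apply: lt_le_trans (F_le_G s0 SL0); rewrite lte_fin F0.
(* If G s = +oo, its negative power is 0 and the right-hand side vanishes. *)
case E : (G s) Gs0 => [g| |//] g0; last by rewrite epowery_neg// mul0e.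
rewrite lte_fin in g0; rewrite epower_EFin// (G_sup t0).
apply: ge_epower_sup => //; [exact: SL0|exact: powR_gt0|by move=> L; exact: F0|].
move=> L SL; apply: le_trans (F_le_G r0 SL); rewrite lee_fin.
apply: (@le_trans _ _ (F s L `^ exponent1 r s t * F t L `^ exponent2 r s t)%R); last first.
  by apply: F_ge => //; [rewrite tr rs|rewrite gt_eqF|rewrite lt_eqF].
rewrite ler_wpM2r ?powR_ge0// -[exponent1 r s t]opprK !(powRN _ (- _)).
rewrite lef_pV2 ?posrE ?powR_gt0 ?F0//.
apply: ge0_ler_powR; rewrite ?nnegrE ?oppr_ge0 ?(ltW a0) ?(ltW g0) ?(ltW (F0 _ SL))//.
by rewrite -lee_fin -E; exact: F_le_G.
Qed.

Lemma positive_optimum_interpolates : interpolates N G.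
Proof.
apply: interpolatesP => r s t rst st.
- exact: interpolation_inf.
- exact: interpolation_sup.
- exact: interpolation_below.
Qed.

End positive.

(* The first alternative is the case where the product of the curvature
   functions vanishes almost everywhere. *)
Lemma optimum_interpolates (V X : R -> I -> \bar R) :
  (forall p L, S L -> V p L = 0) /\
    (forall p L, S L -> (0 < p / (N + p))%R -> 0 < X p L) \/
  (exists v (w : I -> R), [/\ forall p L, S L -> (0 < v p L)%R /\ V p L = (v p L)%:E,
    forall p L, S L -> X p L = (w L `^ (p / (N + p)))%:E,
    forall L, S L -> (0 < w L)%R,
    forall r s t l m L, S L -> (0 < l)%R -> (0 < m)%R ->
      (l + m = 1)%R -> (r = l * s + m * t)%R ->
      (v r L <= v s L `^ l * v t L `^ m)%R &
    forall s, (0 <= s)%R -> exists2 c, (0 < c)%R &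
      forall L, S L -> (c <= v s L * w L `^ (s / N))%R]) ->
  interpolates N (fun p => optimum p
    [set N%:E * epower (V p L) (N / (N + p)) * X p L | L in S]).
Proof.
case=> [[V0 X0]|[v [w [vV wX w0 vc vw]]]].
  apply: degenerate_interpolates => // r.
    move=> r0 Nr; have Nr0 : (0 < N + r)%R by lra.
    have -> : [set N%:E * epower (V r L) (N / (N + r)) * X r L | L in S] = [set 0].
      apply/seteqP; split => [_ [L SL <-]|_ ->] /=.
        by rewrite V0// epower0_pos ?divr_gt0// mule0 mul0e.
      by exists L0 => //; rewrite V0// epower0_pos ?divr_gt0// mule0 mul0e.
    by rewrite /optimum; case: ifP => _; rewrite ?ereal_inf1 ?ereal_sup1.
  move=> Nr; have Nr0 : (N + r < 0)%R by lra.
  have r0 : (r < 0)%R by rewrite (lt_trans Nr)// oppr_lt0.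
  (* A single member equal to +oo suffices. The product is not 0 * oo, because r / (N + r) is a
     quotient of negative numbers and X is therefore positive. *)
  rewrite /optimum (lt_gtF r0); apply: ereal_supy; exists L0 => //.
  rewrite V0// epower0_neg; last by rewrite pmulr_rlt0// invr_lt0.
  by rewrite gt0_muley ?lte_fin// gt0_mulye// X0// -mulrNN -invrN divr_gt0// oppr_gt0.
suff -> : (fun p => optimum p
    [set N%:E * epower (V p L) (N / (N + p)) * X p L | L in S]) =
    fun p => optimum p [set (functional N p (v p L) (w L))%:E | L in S].
  apply: positive_optimum_interpolates => //.
  by move=> p L SL; have [] := vV p L SL.
apply/funext => p; congr optimum; apply: eq_imagel => L SL.
have [v0 ->] := vV p L SL.
by rewrite epower_EFin// wX// /functional !EFinM.
Qed.

End optimum_interpolation.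

(** * The three kinds of mixed geominimal surface area *)

Section geominimal_interpolation.
Context {R : realType} {n : nat} (n0 : (0 < n)%N) (K : 'I_n -> set 'rV[R]_n).
Hypothesis hK : forall i, F0 (K i).

Let N0 : 0 < n%:R :> R. Proof. by rewrite ltr0n. Qed.

Let K0K i : K0 (K i). Proof. by case: (hK i). Qed.

Let total_density :=
  (\int[@spherical_measure R n]_(u in @sphere R n) (mixed_density K u)%:E)%E.

Let total_density_eq0Vgt0 : total_density = 0%E \/ (0 < total_density)%E.
Proof.
have : (0 <= total_density)%E.
  by apply: integral_ge0 => u Su; rewrite lee_fin mixed_density_ge0.
by rewrite le_eqVlt => /orP[/eqP<-|]; [left|right].
Qed.

Let Vp_pos p L : (0 < total_density)%E -> (forall i, K0 (L i)) ->
  0 < fine (Vp p K L) /\ Vp p K L = (fine (Vp p K L))%:E.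
Proof. by move=> I0 KL; split; [exact: fine_Vp_gt0|rewrite fineK_Vp]. Qed.

Let volume_pos (L : set 'rV[R]_n) : K0 L -> 0 < fine (volume (polar L)).
Proof. by move=> KL; rewrite fine_gt0// volume_polar_gt0// volume_polar_lty. Qed.

Let epower_volume (L : set 'rV[R]_n) p : K0 L ->
  epower (volume (polar L)) p = (fine (volume (polar L)) `^ p)%:E.
Proof.
move=> KL; rewrite -epower_EFin ?volume_pos// fineK//.
by rewrite ge0_fin_numE// volume_polar_lty.
Qed.

Let epower_volumes (L : 'I_n -> set 'rV[R]_n) p : (forall i, K0 (L i)) ->
  (\prod_(i < n) epower (volume (polar (L i))) (p / ((n%:R + p) * n%:R)) =
  ((\prod_(i < n) fine (volume (polar (L i))) `^ n%:R^-1) `^ (p / (n%:R + p)))%:E)%E.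
Proof.
move=> KL; rewrite powR_prod; last by move=> i; exact: powR_ge0.
rewrite -prodEFin; apply: eq_bigr => i _; rewrite epower_volume// -powRrM.
by congr (_ `^ _)%:E; rewrite invfM mulrA mulrC.
Qed.

Lemma geominimal1_interpolates : interpolates n%:R (fun p => geominimal1 p K).
Proof.
apply: (optimum_interpolates (K0K (Ordinal n0)) N0); case: total_density_eq0Vgt0 => I0.
  left; split => [p L KL|p L KL p0]; first exact: Vp_eq0.
  by rewrite epower_volume// lte_fin powR_gt0// volume_pos.
right; exists (fun p L => fine (Vp p K (fun=> L))), (fun L => fine (volume (polar L))).
split.
- by move=> p L KL; apply: Vp_pos.
- by move=> p L KL; rewrite epower_volume.
- exact: volume_pos.
- by move=> r s t l m L KL; apply: fine_Vp_log_convex.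
move=> s s0; have [c c0 hc] := Vp_volume_lower_bound n0 hK I0 s0.
(* For a constant family the geometric mean of the polar volumes is the polar volume itself. *)
exists c => // L KL; have := hc (fun=> L) (fun=> KL).
by rewrite (prod_powR_invn n0)// ltW// volume_pos.
Qed.

Lemma geominimal2_interpolates : interpolates n%:R (fun p => geominimal2 p K).
Proof.
have pos (L : 'I_n -> set 'rV[R]_n) : (forall i, K0 (L i)) ->
    0 < \prod_(i < n) fine (volume (polar (L i))) `^ n%:R^-1.
  by move=> KL; apply: prodr_gt0 => i _; rewrite powR_gt0// volume_pos.
apply: (optimum_interpolates (S := [set L : 'I_n -> set 'rV[R]_n | forall i, K0 (L i)]) K0K N0).
case: total_density_eq0Vgt0 => I0.
  left; split => [p L KL|p L KL p0]; first exact: Vp_eq0.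
  by rewrite epower_volumes// lte_fin powR_gt0// pos.
right; exists (fun p L => fine (Vp p K L)).
exists (fun L => \prod_(i < n) fine (volume (polar (L i))) `^ n%:R^-1).
split.
- by move=> p L KL; apply: Vp_pos.
- by move=> p L KL; rewrite epower_volumes.
- exact: pos.
- by move=> r s t l m L KL; apply: fine_Vp_log_convex.
by move=> s s0; exact: (Vp_volume_lower_bound n0 hK I0 s0).
Qed.

Lemma geominimal3_interpolates : interpolates n%:R (fun p => geominimal3 p K).
Proof.
pose W (L : 'I_n -> set 'rV[R]_n) := fine (dual_mixed_volume (fun i => polar (L i))).
have WE L p : (forall i, K0 (L i)) ->
    epower (dual_mixed_volume (fun i => polar (L i))) p = (W L `^ p)%:E.
  move=> KL; rewrite -epower_EFin ?fine_dual_mixed_volume_gt0//.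
  by rewrite fineK_dual_mixed_volume.
apply: (optimum_interpolates (S := [set L : 'I_n -> set 'rV[R]_n | forall i, K0 (L i)]) K0K N0).
case: total_density_eq0Vgt0 => I0.
  left; split => [p L KL|p L KL p0]; first exact: Vp_eq0.
  by rewrite WE// lte_fin powR_gt0// fine_dual_mixed_volume_gt0.
right; exists (fun p L => fine (Vp p K L)), W; split.
- by move=> p L KL; apply: Vp_pos.
- by move=> p L KL; rewrite WE.
- by move=> L KL; exact: fine_dual_mixed_volume_gt0.
- by move=> r s t l m L KL; apply: fine_Vp_log_convex.
by move=> s s0; exact: (Vp_dual_mixed_volume_lower_bound n0 hK I0 s0).
Qed.

End geominimal_interpolation.

Theorem theorem5p5 (R : realType) (n : nat) (K : 'I_n -> set 'rV[R]_n)
    (hK : forall i, F0 (K i)) (alpha : 'I_3) (r s t : R) :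
  let a := ((t - r) * (n%:R + s)) / ((t - s) * (n%:R + r)) in
  let b := ((r - s) * (n%:R + t)) / ((t - s) * (n%:R + r)) in
  let G := fun p : R => geominimal alpha p K in
  [/\ [&& - n%:R < t, t < 0, 0 < r & r < s] \/
      [&& - n%:R < s, s < 0, 0 < r & r < t] ->
        (G r <= epower (G s) a * epower (G t) b)%E,
      [&& - n%:R < t, t < r, r < s & s < 0] \/
      [&& - n%:R < s, s < r, r < t & t < 0] ->
        (G r <= epower (G s) a * epower (G t) b)%E
    & [&& t < r, r < - n%:R, - n%:R < s & s < 0] \/
      [&& s < r, r < - n%:R, - n%:R < t & t < 0] ->
        (G r >= epower (G s) a * epower (G t) b)%E].
Proof.
move=> a b G.
(* In dimension 0 all cases are void: each asks for a number strictly between -n and 0. *)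
have [n0|n0] := posnP n.
  have nR0 : n%:R = 0 :> R by rewrite n0.
  split => -[]; rewrite nR0 oppr0 => /and4P[h1 h2 h3 h4]; exfalso;
  by move: h1 h2 h3 h4; clear; lra.
suff : interpolates n%:R G by apply.
rewrite /G /geominimal; case: (val alpha) => [|[|_]].
- exact: geominimal1_interpolates.
- exact: geominimal2_interpolates.
- exact: geominimal3_interpolates.
Qed.
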